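(* Let $(b_N)_N$ be a sequence of integers with $0\le b_N\le N-1$, let $w_N:=\min(N,2b_N+1)$, and suppose that there exist positive constants $c$ and $q$ such that $w_N\ge cN^q$ for all $N$. Let $(\xi_i)_{i\in\mathbb{N}}$ be an exchangeable sequence of real-valued random variables on $(\Omega,\mathcal{F},\mathbb{P})$ with finite moments of all orders, let $M$ be its limiting empirical mean, and let $(F_N)_N$ and $(F_N^{\mathrm{per}})_N$ be, respectively, a strict and a periodic de Finetti band ensemble with half-widths $b_N$ whose entries are drawn from $(\xi_i)_i$. I. In both cases $X_N=F_N$ and $X_N=F_N^{\mathrm{per}}$, $$\mathbb{P}\Big(\limsup_{N\to\infty}\frac{\|X_N\|_{op}}{w_N}\le|M(\omega)|\Big)=1\quad\text{and}\quad\mathbb{P}\Big(\liminf_{N\to\infty}\frac{\|X_N\|_{op}}{w_N}\ge\tfrac34|M(\omega)|\Big)=1.$$ II. In the case $X_N=F_N^{\mathrm{per}}$ of periodic ensembles, one has the stronger result $$\mathbb{P}\Big(\lim_{N\to\infty}\frac{\|X_N\|_{op}}{w_N}=|M(\omega)|\Big)=1.$$ III. The result displayed in II also holds for strict band matrices $X_N=F_N$ with half-widths $b_N$ satisfying $\lim_{N\to\infty}\frac{b_N}{N}\in\{0,1\}$.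
   Context: An infinite sequence $(\xi_i)_{i\in\mathbb{N}}$ of real random variables is exchangeable if for every $n$ and every permutation $\pi$ of $\{1,\dots,n\}$ the vectors $(\xi_1,\dots,\xi_n)$ and $(\xi_{\pi(1)},\dots,\xi_{\pi(n)})$ have the same distribution. The limiting empirical mean $M$ of such a sequence is the $\mathbb{P}$-almost sure limit (which exists) of $M_n:=\frac1n\sum_{i=1}^n\xi_i$ as $n\to\infty$. De Finetti band ensembles with half-widths $b_N$: real symmetric random $N\times N$ matrices $F_N$ (strict) resp. $F_N^{\mathrm{per}}$ (periodic) such that the $(i,j)$ entry is zero whenever $|i-j|>b_N$ (strict) resp. $|i-j|_N>b_N$ (periodic), where $|i|_N:=\min(|i|,N-|i|)$ for $|i|\le N$; for each $N$ the remaining entries with $1\le i\le j\le N$, say $L_N$ many, are filled, in some order and each variable used exactly once, by the first $L_N$ members $\xi_1,\dots,\xi_{L_N}$ of the fixed exchangeable sequence; the entries below the diagonal are determined by symmetry. The number $w_N$ is called the bandwidth. $\|\cdot\|_{op}$ denotes the $\ell_2$-operator norm, which for a real symmetric matrix is the largest modulus of its eigenvalues. *)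

(* Defs.v *)
From HB Require Import structures.
From mathcomp Require Import all_boot all_order all_algebra.
From mathcomp Require Import perm.
From mathcomp Require Import all_classical all_reals all_analysis.

Set Implicit Arguments.
Unset Strict Implicit.
Unset Printing Implicit Defensive.

Import Order.TTheory GRing.Theory Num.Theory.
Import numFieldNormedType.Exports.

Local Open Scope classical_set_scope.
Local Open Scope ring_scope.

(* Sequences are indexed from 0: [xi i] is the (i+1)-st variable of the
   sequence.  Equality in law of two random vectors is tested on the
   measurable sets of the product sigma-algebra of [n.-tuple R]. *)
Definition exchangeable (d : measure_display) (T : measurableType d)
    (R : realType) (P : probability T R) (xi : nat -> {RV P >-> R}) : Prop :=
  forall (n : nat) (s : 'S_n) (A : set (n.-tuple R)), measurable A ->
    P ((fun w => [tuple xi i w | i < n]) @^-1` A) =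
    P ((fun w => [tuple xi (s i) w | i < n]) @^-1` A).

Definition finite_moments (d : measure_display) (T : measurableType d)
    (R : realType) (P : probability T R) (X : {RV P >-> R}) : Prop :=
  forall k : nat, P.-integrable setT (fun w => (X w ^+ k)%:E).

Definition empirical_mean (d : measure_display) (T : measurableType d)
    (R : realType) (P : probability T R) (xi : nat -> {RV P >-> R})
    (n : nat) (w : T) : R :=
  n%:R^-1 * \sum_(i < n) xi i w.

Definition is_limiting_empirical_mean (d : measure_display)
    (T : measurableType d) (R : realType) (P : probability T R)
    (xi : nat -> {RV P >-> R}) (M : {RV P >-> R}) : Prop :=
  {ae P, forall w, empirical_mean xi n w @[n --> \oo] --> M w}.

Definition strict_dist (N i j : nat) : nat := `|i - j|%N.

Definition periodic_dist (N i j : nat) : nat :=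
  minn `|i - j|%N (N - `|i - j|%N).

Definition band (dist : nat -> nat -> nat -> nat) (b N : nat) :
    {set 'I_N * 'I_N} :=
  [set p : 'I_N * 'I_N | (p.1 <= p.2)%N && (dist N p.1 p.2 <= b)%N]%SET.

(* The sequence [s] lists the band positions on and above the diagonal, each
   exactly once: it is the order in which they are filled, the position of
   index k in [s] receiving [xi k].  It may depend on N but not on the sample
   point. *)
Definition de_finetti_band_ensemble (dist : nat -> nat -> nat -> nat)
    (d : measure_display) (T : measurableType d) (R : realType)
    (P : probability T R) (b : nat -> nat) (xi : nat -> {RV P >-> R})
    (X : forall N : nat, T -> 'M[R]_N) : Prop :=
  forall N : nat,
    [/\ forall w, (X N w)^T = X N w,
        forall w (i j : 'I_N), (b N < dist N i j)%N -> X N w i j = 0 &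
        exists s : seq ('I_N * 'I_N),
          perm_eq s (enum (band dist (b N) N)) /\
          forall w (p : 'I_N * 'I_N), p \in s ->
            X N w p.1 p.2 = xi (index p s) w].

Definition bandwidth (b : nat -> nat) (N : nat) : nat :=
  minn N (2 * b N + 1).

(* The library's norm on matrices is the entrywise maximum, hence the explicit
   Euclidean norm. *)
Definition l2norm (R : realType) (n : nat) (x : 'cV[R]_n) : R :=
  Num.sqrt (\sum_(i < n) x i 0 ^+ 2).

Definition opnorm (R : realType) (n : nat) (A : 'M[R]_n) : R :=
  sup [set l2norm (A *m x) | x in [set x : 'cV[R]_n | l2norm x <= 1]].

Definition scaled_opnorm (T : Type) (R : realType) (b : nat -> nat)
    (X : forall N : nat, T -> 'M[R]_N) (w : T) (N : nat) : R :=
  opnorm (X N w) / (bandwidth b N)%:R.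

(* Main.v *)
(* Write [X_N = m B_N + Y_N], where [B_N] is the 0/1 band matrix, [m] is the
   empirical mean of the first [n] variables and [Y_N] carries the centered
   entries [eta_i = xi_i - m].  Taking [n] much larger than the number of
   entries replaces de Finetti's theorem: as the [eta_i], [i < n], are
   exchangeable and sum to zero, the expectation of a monomial in which some
   [eta_i] occurs exactly once is [O(1/n)].

   To see that [||Y_N|| = o(w_N)] almost surely, apply Schur's test to [Y_N^2].
   Each row of it has at most [2 w_N] nonzero entries.  The off-diagonal ones
   are, up to two terms, sums of at most [w_N] products of distinct [eta]'s, so
   their [2k]-th moments are [O(w_N^k)] instead of [O(w_N^(2k))].  As
   [w_N >= c N^q], for large [k] the normalised moments are summable over [N]
   even after a union bound over the [N^2] entries.

   Finally [||B_N|| <= w_N], and testing [B_N] against the constant vector gives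
   [||B_N|| >= rho_N w_N], where [rho_N], the number of ones divided by
   [N w_N], is [1] in the periodic case, at least [3/4] in the strict case, and
   tends to [1] in the strict case when [b_N / N] tends to [0] or [1]. *)

Require Import Defs.
From HB Require Import structures.
From mathcomp Require Import all_boot all_order all_algebra.
From mathcomp Require Import all_classical all_reals all_analysis.
From mathcomp Require Import measurable_realfun.
From mathcomp Require Import perm ring lra zify.

Set Implicit Arguments.
Unset Strict Implicit.
Unset Printing Implicit Defensive.

Import Order.TTheory GRing.Theory Num.Theory.
Import numFieldNormedType.Exports.

Local Open Scope classical_set_scope.
Local Open Scope ring_scope.

(** * Euclidean operator norm *)

Section EuclideanNorm.
Variable R : realType.

Lemma l2norm_ge0 n (x : 'cV[R]_n) : 0 <= l2norm x.
Proof. exact: sqrtr_ge0. Qed.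

Lemma l2norm_sqr n (x : 'cV[R]_n) : l2norm x ^+ 2 = \sum_(i < n) x i 0 ^+ 2.
Proof. by rewrite sqr_sqrtr// sumr_ge0// => i _; rewrite sqr_ge0. Qed.

Lemma l2norm0 n : l2norm (0 : 'cV[R]_n) = 0.
Proof.
by rewrite /l2norm big1 ?sqrtr0// => i _; rewrite mxE expr0n.
Qed.

Lemma l2normZ n (a : R) (x : 'cV[R]_n) : l2norm (a *: x) = `|a| * l2norm x.
Proof.
rewrite /l2norm -sqrtr_sqr -sqrtrM ?sqr_ge0// mulr_sumr.
by congr Num.sqrt; apply: eq_bigr => i _; rewrite mxE exprMn.
Qed.

Lemma l2norm_le n (x : 'cV[R]_n) (c : R) : 0 <= c ->
  (l2norm x <= c) = (\sum_(i < n) x i 0 ^+ 2 <= c ^+ 2).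
Proof. by move=> c0; rewrite -l2norm_sqr ler_pXn2r ?nnegrE// l2norm_ge0. Qed.

(** Lagrange's identity: twice the defect in the squared inequality is the sum of the squares
    [(x_i y_j - x_j y_i)^2] over all [i] and [j]. *)
Lemma cauchy_schwarz n (x y : 'cV[R]_n) :
  \sum_(i < n) x i 0 * y i 0 <= l2norm x * l2norm y.
Proof.
set s := \sum_(i < n) _.
have sqr_le : s ^+ 2 <= (l2norm x * l2norm y) ^+ 2.
  rewrite exprMn !l2norm_sqr -subr_ge0.
  suff : 0 <= 2 * ((\sum_(i < n) x i 0 ^+ 2) * (\sum_(i < n) y i 0 ^+ 2) - s ^+ 2).
    by rewrite pmulr_rge0.
  have -> : 2 * ((\sum_(i < n) x i 0 ^+ 2) * (\sum_(i < n) y i 0 ^+ 2) - s ^+ 2)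
     = \sum_(i < n) \sum_(j < n) (x i 0 * y j 0 - x j 0 * y i 0) ^+ 2.
    transitivity (\sum_(i < n) \sum_(j < n) (x i 0 ^+ 2 * y j 0 ^+ 2) +
       \sum_(i < n) \sum_(j < n) (y i 0 ^+ 2 * x j 0 ^+ 2)
       - 2 * \sum_(i < n) \sum_(j < n) ((x i 0 * y i 0) * (x j 0 * y j 0))).
      rewrite mulrBr expr2 /s !big_distrlr/=; congr (_ - _).
      rewrite [X in _ = _ + X]exchange_big/= mulrDl mul1r.
      by congr (_ + _); do 2!apply: eq_bigr => ? _; rewrite mulrC.
    rewrite mulr_sumr -sumrN -!big_split/=; apply: eq_bigr => i _.
    rewrite mulr_sumr -sumrN -!big_split/=; apply: eq_bigr => j _; ring.
  by do 2!(apply: sumr_ge0 => ? _); rewrite sqr_ge0.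
have [s0|s0] := leP 0 s.
  by rewrite -(@ler_pXn2r _ 2)// nnegrE ?mulr_ge0 ?l2norm_ge0.
by apply: le_trans (ltW s0) _; rewrite mulr_ge0 ?l2norm_ge0.
Qed.

Lemma l2normD n (x y : 'cV[R]_n) : l2norm (x + y) <= l2norm x + l2norm y.
Proof.
rewrite l2norm_le ?addr_ge0 ?l2norm_ge0// sqrrD !l2norm_sqr.
apply: (@le_trans _ _ (\sum_(i < n) x i 0 ^+ 2 +
    (\sum_(i < n) x i 0 * y i 0) *+ 2 + \sum_(i < n) y i 0 ^+ 2)).
  by rewrite -sumrMnl -!big_split/= ler_sum// => i _; rewrite mxE sqrrD.
by rewrite lerD2r lerD2l lerMn2r/= cauchy_schwarz.
Qed.

Lemma l2normN n (x : 'cV[R]_n) : l2norm (- x) = l2norm x.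
Proof. by rewrite -scaleN1r l2normZ normrN1 mul1r. Qed.

(** Schur's test: [|x_i x_j|] is at most [(x_i^2 + x_j^2) / 2], and by the symmetry of [G] the two
    halves have the same sum. *)
Lemma quadratic_form_sym_le n (G : 'I_n -> 'I_n -> R) (K : R) (x : 'I_n -> R) :
  (forall i j, G i j = G j i) -> (forall i, \sum_(j < n) `|G i j| <= K) ->
  \sum_(i < n) \sum_(j < n) G i j * (x i * x j) <= K * \sum_(i < n) x i ^+ 2.
Proof.
move=> symG rowG.
have rowle : \sum_(i < n) \sum_(j < n) `|G i j| * x i ^+ 2 <=
    K * \sum_(i < n) x i ^+ 2.
  rewrite mulr_sumr ler_sum// => i _.
  by rewrite -mulr_suml ler_wpM2r// sqr_ge0.
apply: (@le_trans _ _
  (2^-1 * (\sum_(i < n) \sum_(j < n) `|G i j| * x i ^+ 2 +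
   \sum_(i < n) \sum_(j < n) `|G i j| * x j ^+ 2))); last first.
  rewrite [X in _ + X]exchange_big/=.
  have -> : \sum_(j < n) \sum_(i < n) `|G i j| * x j ^+ 2 =
      \sum_(i < n) \sum_(j < n) `|G i j| * x i ^+ 2.
    by do 2!apply: eq_bigr => ? _; rewrite symG.
  by move: rowle; set S := (\sum_(i < n) \sum_(j < n) _); lra.
rewrite -big_split/= mulr_sumr ler_sum// => i _.
rewrite -big_split/= mulr_sumr ler_sum// => j _.
apply: le_trans (ler_norm _) _; rewrite normrM -mulrDr mulrCA ler_wpM2l//.
by have := sqr_ge0 (`|x i| - `|x j|); rewrite normrM sqrrB !real_normK ?num_real//; lra.
Qed.

(** The squared norm of [A *m x] is the quadratic form of the Gram matrix [A^T A] at [x], to which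
    Schur's test applies. *)
Lemma l2norm_mulmx_le n (A : 'M[R]_n) (K : R) : 0 <= K ->
  (forall i, \sum_(j < n) `|\sum_(l < n) A l i * A l j| <= K) ->
  forall x, l2norm (A *m x) <= Num.sqrt K * l2norm x.
Proof.
move=> K0 rowK x.
rewrite l2norm_le ?mulr_ge0 ?sqrtr_ge0 ?l2norm_ge0//.
rewrite exprMn sqr_sqrtr// l2norm_sqr.
apply: le_trans (quadratic_form_sym_le (fun i => x i 0) _ rowK).
  rewrite [leRHS](_ : _ = \sum_(i < n) \sum_(j < n) \sum_(l < n)
     (A l i * x i 0) * (A l j * x j 0)); last first.
    by do 2!apply: eq_bigr => ? _; rewrite mulr_suml; apply: eq_bigr => l _; ring.
  have -> : \sum_(i < n) \sum_(j < n) \sum_(l < n)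
     (A l i * x i 0) * (A l j * x j 0) = \sum_(i < n) \sum_(l < n) \sum_(j < n)
     (A l i * x i 0) * (A l j * x j 0).
    by apply: eq_bigr => ? _; rewrite exchange_big.
  rewrite exchange_big/= ler_sum// => l _.
  by rewrite mxE expr2 big_distrlr.
by move=> i j; apply: eq_bigr => l _; rewrite mulrC.
Qed.

(** A crude constant: it makes the set in [opnorm] bounded, so that its supremum is a genuine
    one. *)
Lemma mulmx_bounded n (A : 'M[R]_n) :
  exists2 K : R, 0 <= K & forall x, l2norm (A *m x) <= K * l2norm x.
Proof.
pose K := \sum_(i < n) \sum_(j < n) `|\sum_(l < n) A l i * A l j|.
have K0 : 0 <= K by do 2!(apply: sumr_ge0 => ? _).
exists (Num.sqrt K); first exact: sqrtr_ge0.
apply: l2norm_mulmx_le => // i; rewrite /K [leRHS](bigD1 i)//= lerDl.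
by do 2!(apply: sumr_ge0 => ? _).
Qed.

Lemma opnorm_le n (A : 'M[R]_n) (K : R) : 0 <= K ->
  (forall x, l2norm (A *m x) <= K * l2norm x) -> opnorm A <= K.
Proof.
move=> K0 AK; apply: ge_sup.
  by exists (l2norm (A *m 0)), 0 => //=; rewrite l2norm0.
move=> _ [x /= x1 <-]; apply: le_trans (AK x) _.
by rewrite ler_piMr.
Qed.

Lemma l2norm_mulmx_opnorm n (A : 'M[R]_n) x :
  l2norm (A *m x) <= opnorm A * l2norm x.
Proof.
have [K K0 AK] := mulmx_bounded A.
have ub : has_ubound [set l2norm (A *m x) | x in [set x : 'cV[R]_n | l2norm x <= 1]].
  exists K => _ [y /= y1 <-]; apply: le_trans (AK y) _.
  by rewrite ler_piMr.
have [x0|x0] := eqVneq (l2norm x) 0.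
  by have := AK x; rewrite x0 !mulr0.
have xp : 0 < l2norm x by rewrite lt_neqAle eq_sym x0 l2norm_ge0.
rewrite -ler_pdivrMr//; apply: ub_le_sup => //.
exists ((l2norm x)^-1 *: x) => /=.
  by rewrite l2normZ ger0_norm ?invr_ge0 ?l2norm_ge0// mulVf.
by rewrite -scalemxAr l2normZ ger0_norm ?invr_ge0 ?l2norm_ge0// mulrC.
Qed.

Lemma opnorm_ge0 n (A : 'M[R]_n) : 0 <= opnorm A.
Proof.
have [K K0 AK] := mulmx_bounded A.
apply: le_trans (l2norm_ge0 (A *m 0)) _; apply: ub_le_sup.
  exists K => _ [y /= y1 <-]; apply: le_trans (AK y) _.
  by rewrite ler_piMr.
by exists 0 => //=; rewrite l2norm0.
Qed.

Lemma opnorm_leP n (A : 'M[R]_n) (K : R) : 0 <= K ->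
  (opnorm A <= K) <-> (forall x, l2norm (A *m x) <= K * l2norm x).
Proof.
move=> K0; split=> [AK x|]; last exact: opnorm_le.
by apply: le_trans (l2norm_mulmx_opnorm A x) _; rewrite ler_wpM2r// l2norm_ge0.
Qed.

Lemma opnormD n (A B : 'M[R]_n) : opnorm (A + B) <= opnorm A + opnorm B.
Proof.
apply/opnorm_leP => [|x]; first by rewrite addr_ge0// opnorm_ge0.
rewrite mulmxDl mulrDl; apply: le_trans (l2normD _ _) _.
by rewrite lerD// l2norm_mulmx_opnorm.
Qed.

Lemma opnormN n (A : 'M[R]_n) : opnorm (- A) = opnorm A.
Proof.
rewrite /opnorm; congr (sup [set _ | _ in _]).
suff -> : (fun x => l2norm (- A *m x)) = (fun x => l2norm (A *m x)) by [].
by apply/funext => x; rewrite mulNmx l2normN.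
Qed.

Lemma opnormZ_le n (a : R) (A : 'M[R]_n) : opnorm (a *: A) <= `|a| * opnorm A.
Proof.
apply/opnorm_leP => [|x]; first by rewrite mulr_ge0// opnorm_ge0.
by rewrite -scalemxAl l2normZ -mulrA ler_wpM2l// l2norm_mulmx_opnorm.
Qed.

Lemma opnormZ n (a : R) (A : 'M[R]_n) : opnorm (a *: A) = `|a| * opnorm A.
Proof.
apply/eqP; rewrite eq_le opnormZ_le/=.
have [->|a0] := eqVneq a 0; first by rewrite normr0 mul0r opnorm_ge0.
rewrite -ler_pdivlMl ?normr_gt0//.
have := opnormZ_le a^-1 (a *: A).
by rewrite scalerA mulVf// scale1r normfV.
Qed.

(** With [u] the all-ones vector, the sum of the entries is [u^T A u], which Cauchy-Schwarz bounds
    by [opnorm A * l2norm u ^+ 2], that is, by [opnorm A * n]. *)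
Lemma opnorm_ge_avg n (A : 'M[R]_n) :
  (\sum_(i < n) \sum_(j < n) A i j) / n%:R <= opnorm A.
Proof.
case: n A => [|n] A; first by rewrite big_ord0 mul0r opnorm_ge0.
pose u : 'cV[R]_n.+1 := const_mx 1.
have uE : l2norm u ^+ 2 = n.+1%:R.
  rewrite l2norm_sqr (eq_bigr (fun=> 1)) => [|i _]; last by rewrite mxE expr1n.
  by rewrite sumr_const card_ord.
rewrite ler_pdivrMr ?ltr0n// -uE expr2 mulrA.
apply: (@le_trans _ _ (\sum_(i < n.+1) (A *m u) i 0 * u i 0)).
  rewrite ler_sum// => i _; rewrite !mxE mulr1 ler_sum// => j _.
  by rewrite mxE mulr1.
apply: le_trans (cauchy_schwarz _ _) _.
by rewrite ler_wpM2r ?l2norm_ge0// l2norm_mulmx_opnorm.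
Qed.

End EuclideanNorm.

(** * Measurability of the operator norm *)

Section OpnormMeasurable.
Variable R : realType.

Lemma rat_vector_dense n (x : 'cV[R]_n) (e : R) : 0 < e ->
  exists q : 'cV[rat]_n, l2norm (x - map_mx ratr q) <= e.
Proof.
(* Precision [r] in each coordinate suffices because [n * r ^+ 2 <= e ^+ 2]; the successor covers
   [n = 0]. *)
move=> e0; pose r := e / n.+1%:R.
have r0 : 0 < r by rewrite divr_gt0.
have /choice[q qP] : forall i : 'I_n, exists q : rat, x i 0 - r < ratr q < x i 0 + r.
  move=> i; have /rat_in_itvoo[q] : x i 0 - r < x i 0 + r by lra.
  by rewrite in_itv/= => qP; exists q.
exists (\col_i q i); rewrite l2norm_le ?(ltW e0)//.
apply: (@le_trans _ _ (\sum_(i < n) r ^+ 2)).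
  rewrite ler_sum// => i _; rewrite !mxE -ler_sqrt ?sqr_ge0// !sqrtr_sqr.
  rewrite (ger0_norm (ltW r0)) ler_norml; have := qP i; lra.
rewrite sumr_const card_ord -mulr_natr exprMn -mulrA ler_piMr ?sqr_ge0//.
rewrite exprVn -ler_pdivlMl ?invr_gt0 ?exprn_gt0// invrK mulr1.
by rewrite -natrX ler_nat; nia.
Qed.

(** An enumeration of the rational vectors by their codes. Numbers that code nothing give the zero
    vector, whose quotient below is [0] since the inverse of [0] is [0]. *)
Let ratvec n (m : nat) : 'cV[R]_n := map_mx ratr (odflt 0 (unpickle m)).

(** The density of the rational vectors replaces the supremum over a continuum by a countable one,
    which preserves measurability. *)
Lemma opnorm_countable_sup n (A : 'M[R]_n) :
  opnorm A = sups (fun m => l2norm (A *m ratvec n m) / l2norm (ratvec n m)) 0.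
Proof.
set f := fun m => _; set s := sups f 0.
have fub m : f m <= opnorm A.
  rewrite /f; have [->|q0] := eqVneq (l2norm (ratvec n m)) 0.
    by rewrite invr0 mulr0 opnorm_ge0.
  by rewrite ler_pdivrMr ?l2norm_mulmx_opnorm// lt_neqAle eq_sym q0 l2norm_ge0.
have hub : has_ubound (sdrop f 0) by exists (opnorm A) => _ [m _ <-].
have fs m : f m <= s by apply: ub_le_sup => //; exists m.
have s0 : 0 <= s by apply: le_trans (fs 0%N); rewrite divr_ge0 ?l2norm_ge0.
apply/eqP; rewrite eq_le; apply/andP; split; last first.
  by apply: ge_sup => [|_ [m _ <-]//]; exists (f 0%N), 0%N.
apply/opnorm_leP => // x; apply/ler_addgt0Pr => e e0.
(* Replacing [x] by a rational vector within [e / K] costs [s * (e / K)] through the norm of the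
   vector and [opnorm A * (e / K)] through its image, together at most [e]. *)
pose K := s + opnorm A + 1.
have K0 : 0 < K by rewrite ltr_pwDr// addr_ge0// opnorm_ge0.
have [q xq] := rat_vector_dense x (divr_gt0 e0 K0).
have Aq : l2norm (A *m map_mx ratr q) <= s * l2norm (map_mx ratr q : 'cV[R]_n).
  have [q0|q0] := eqVneq (l2norm (map_mx ratr q : 'cV[R]_n)) 0.
    by have := l2norm_mulmx_opnorm A (map_mx ratr q); rewrite q0 !mulr0.
  rewrite -ler_pdivrMr ?lt_neqAle 1?eq_sym ?q0 ?l2norm_ge0//.
  by have := fs (pickle q); rewrite /f /ratvec pickleK.
have -> : A *m x = A *m map_mx ratr q + A *m (x - map_mx ratr q).
  by rewrite -mulmxDr addrC subrK.
apply: le_trans (l2normD _ _) _.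
have qx : l2norm (map_mx ratr q : 'cV[R]_n) <= l2norm x + e / K.
  have -> : map_mx ratr q = x + - (x - map_mx ratr q) :> 'cV[R]_n.
    by rewrite opprB addrC subrK.
  by apply: le_trans (l2normD _ _) _; rewrite l2normN lerD2l.
apply: (@le_trans _ _ (s * (l2norm x + e / K) + opnorm A * (e / K))).
  apply: lerD; first by apply: le_trans Aq _; rewrite ler_wpM2l.
  by apply: le_trans (l2norm_mulmx_opnorm _ _) _; rewrite ler_wpM2l ?opnorm_ge0.
have : K * (e / K) = e by rewrite mulrCA mulfV ?mulr1// gt_eqF.
have : 0 <= e / K by rewrite divr_ge0 ?ltW.
rewrite /K; move: (e / _) => y; nra.
Qed.

Lemma measurable_opnorm d (T : measurableType d) n (A : T -> 'M[R]_n) :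
  (forall i j, measurable_fun setT (fun w => A w i j)) ->
  measurable_fun setT (fun w => opnorm (A w)).
Proof.
move=> mA.
under eq_fun do rewrite opnorm_countable_sup.
apply: (@measurable_fun_sups _ _ _ setT
  (fun m w => l2norm (A w *m ratvec n m) / l2norm (ratvec n m)) 0%N) => //.
  move=> w _; exists (opnorm (A w)) => _ [m _ <-].
  have [->|q0] := eqVneq (l2norm (ratvec n m)) 0.
    by rewrite invr0 mulr0 opnorm_ge0.
  by rewrite ler_pdivrMr ?l2norm_mulmx_opnorm// lt_neqAle eq_sym q0 l2norm_ge0.
move=> m; apply: measurable_funM => //.
apply: (@measurableT_comp _ _ _ _ _ _ (Num.sqrt : R -> R)).
  by apply: continuous_measurable_fun => x; exact: sqrt_continuous.
apply: measurable_sum => i; apply: measurable_funX.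
under eq_fun do rewrite mxE.
by apply: measurable_sum => j; apply: measurable_funM.
Qed.

End OpnormMeasurable.

(** * Moments of centered exchangeable variables *)

Section ElementaryInequalities.
Variable R : realType.

(** Induction on [p]; the step is Chebyshev's sum inequality for the similarly ordered families
    [x i] and [x i ^+ p.+1]. *)
Lemma power_mean n (x : 'I_n -> R) (p : nat) : (forall i, 0 <= x i) ->
  (\sum_i x i) ^+ p.+1 <= n%:R ^+ p * \sum_i x i ^+ p.+1.
Proof.
move=> x0; elim: p => [|p IHp]; first by rewrite expr0 mul1r.
rewrite exprS; apply: le_trans (ler_wpM2l (sumr_ge0 _ (fun i _ => x0 i)) IHp) _.
rewrite mulrCA exprSr -mulrA ler_wpM2l ?exprn_ge0//.
(* Twice the difference of the two sides is a double sum over [i] and [j] whose terms are products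
   of two factors of the same sign. *)
rewrite -subr_ge0 -(pmulr_rge0 _ (ltr0Sn R 1)).
rewrite [X in 0 <= X](_ : _ = \sum_(i < n) \sum_(j < n)
    (x i - x j) * (x i ^+ p.+1 - x j ^+ p.+1)).
  do 2!(apply: sumr_ge0 => ? _).
  set a := x _; set b := x _.
  have [ab|ba] := leP a b.
    by rewrite mulr_le0// subr_le0// lerXn2r ?nnegrE//; exact: x0.
  by rewrite mulr_ge0// subr_ge0 ?lerXn2r ?nnegrE ?(ltW ba)//; exact: x0.
have sumC (F : 'I_n -> R) : \sum_(i < n) \sum_(j < n) F i = n%:R * \sum_i F i.
  rewrite mulr_sumr; apply: eq_bigr => i _.
  by rewrite sumr_const card_ord mulr_natl.
transitivity (\sum_(i < n) \sum_(j < n) x i ^+ p.+2 +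
    \sum_(i < n) \sum_(j < n) x j ^+ p.+2
    - \sum_(i < n) \sum_(j < n) x i * x j ^+ p.+1
    - \sum_(i < n) \sum_(j < n) x j * x i ^+ p.+1).
  rewrite [X in _ = _ + X - _ - _]exchange_big/=.
  rewrite [X in _ = _ - X]exchange_big/= sumC -big_distrlr/=; lra.
rewrite -!sumrN -!big_split/=; apply: eq_bigr => i _.
rewrite -!sumrN -!big_split/=; apply: eq_bigr => j _.
by rewrite !(exprS _ p.+1); ring.
Qed.

Lemma expr_even_norm (x : R) p : `|x| ^+ (2 * p) = x ^+ (2 * p).
Proof. by rewrite !exprM real_normK// num_real. Qed.

Lemma power_mean_even n (x : 'I_n -> R) (p : nat) : (0 < p)%N ->
  (\sum_i x i) ^+ (2 * p) <= n%:R ^+ (2 * p).-1 * \sum_i x i ^+ (2 * p).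
Proof.
move=> p0; rewrite -expr_even_norm.
apply: (@le_trans _ _ ((\sum_i `|x i|) ^+ (2 * p))).
  by rewrite lerXn2r ?nnegrE ?sumr_ge0// ler_norm_sum.
have -> : (2 * p = (2 * p).-1.+1)%N by rewrite prednK// muln_gt0.
apply: le_trans (power_mean _ (fun i => normr_ge0 (x i))) _.
rewrite ler_wpM2l ?exprn_ge0//= prednK ?muln_gt0//.
by rewrite ler_sum// => i _; rewrite expr_even_norm.
Qed.

(** The product is at most the largest factor to the power [size c], and this power is one of the
    terms of the sum. *)
Lemma prod_le_sum_power (I : eqType) (c : seq I) (y : I -> R) :
  (forall i, 0 <= y i) -> (0 < size c)%N ->
  \prod_(i <- c) y i <= \sum_(i <- c) y i ^+ size c.
Proof.
move=> y0 c0.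
have [m mc maxm] : exists2 m, m \in c & forall i, i \in c -> y i <= y m.
  elim: c c0 => // a [|b c] IH _.
    by exists a; rewrite ?mem_head// => i; rewrite inE => /eqP ->.
  have [//|m mc maxm] := IH; have [am|ma] := leP (y a) (y m).
    exists m; first by rewrite inE mc orbT.
    by move=> i; rewrite inE => /predU1P[->//|]; exact: maxm.
  exists a; first by rewrite mem_head.
  move=> i; rewrite inE => /predU1P[->//|/maxm im].
  exact: le_trans im (ltW ma).
apply: (@le_trans _ _ (y m ^+ size c)).
  have -> : y m ^+ size c = \prod_(i <- c) y m.
    by rewrite big_const_seq count_predT iter_mulr_1.
  by rewrite !big_seq; apply: ler_prod => i ic; rewrite y0 maxm.
by rewrite (big_rem m)//= lerDl sumr_ge0// => i _; rewrite exprn_ge0.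
Qed.

End ElementaryInequalities.

(** * Random variables with moments of all orders *)

Section Moments.
Context d (T : measurableType d) (R : realType) (P : probability T R).
Implicit Types X Y : T -> R.

(** This class is closed under sums and products, so every polynomial in the entries is
    integrable. *)
Definition all_moments X := measurable_fun setT X /\
  forall k, P.-integrable setT (EFin \o (fun w => X w ^+ k)).

Lemma all_moments_integrable X : all_moments X -> P.-integrable setT (EFin \o X).
Proof. by move=> [_ /(_ 1%N)]. Qed.

Lemma all_moments_cst (a : R) : all_moments (fun=> a).
Proof.
by split=> // k; exact: finite_measure_integrable_cst.
Qed.

(** Dominated by integrable squares, through [|a b| <= a^2 + b^2]. *)
Let integrable_mulX X Y : all_moments X -> all_moments Y ->
  forall k l, P.-integrable setT (EFin \o (fun w => X w ^+ k * Y w ^+ l)).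
Proof.
move=> [mX iX] [mY iY] k l.
apply: (@le_integrable _ _ _ _ _ measurableT _
  ((EFin \o (fun w => (X w ^+ (k * 2))%R)) \+
   (EFin \o (fun w => (Y w ^+ (l * 2))%R)) : T -> \bar R)%E).
- apply/measurable_EFinP.
  by apply: measurable_funM; exact: measurable_funX.
- move=> w _ /=; rewrite lee_fin !exprM normrM.
  set a := X w ^+ k; set b := Y w ^+ l.
  rewrite [leRHS]ger0_norm ?addr_ge0 ?sqr_ge0//.
  have := sqr_ge0 (`|a| - `|b|); rewrite sqrrB !real_normK ?num_real//.
  have := mulr_ge0 (normr_ge0 a) (normr_ge0 b); lra.
- exact: integrableD.
Qed.

Lemma all_momentsM X Y : all_moments X -> all_moments Y ->
  all_moments (fun w => X w * Y w).
Proof.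
move=> aX aY; split; first by apply: measurable_funM; [case: aX|case: aY].
move=> k; rewrite [X in EFin \o X](_ : _ = fun w => X w ^+ k * Y w ^+ k).
  exact: integrable_mulX.
by apply/funext => w; rewrite exprMn.
Qed.

Lemma all_momentsD X Y : all_moments X -> all_moments Y ->
  all_moments (fun w => X w + Y w).
Proof.
move=> aX aY; split; first by apply: measurable_funD; [case: aX|case: aY].
move=> k; under [X in _.-integrable _ X]eq_fun => w.
  rewrite /= exprDn -sumEFin; over.
apply: integrable_sum => // i _.
under [X in _.-integrable _ X]eq_fun do rewrite -mulr_natl EFinM.
by apply: integrableZl => //; exact: integrable_mulX.
Qed.

Lemma all_momentsB X Y : all_moments X -> all_moments Y ->
  all_moments (fun w => X w - Y w).
Proof.
move=> aX aY; apply: all_momentsD => //.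
under eq_fun do rewrite -mulN1r.
by apply: all_momentsM => //; exact: all_moments_cst.
Qed.

Lemma all_moments_sum (I : Type) (s : seq I) (Q : pred I) (X : I -> T -> R) :
  (forall i, all_moments (X i)) -> all_moments (fun w => \sum_(i <- s | Q i) X i w).
Proof.
move=> aX; elim: s => [|i s IH].
  by under eq_fun do rewrite big_nil; exact: all_moments_cst.
under eq_fun do rewrite big_cons; case: (Q i) => //.
exact: all_momentsD.
Qed.

Lemma all_moments_prod (I : Type) (s : seq I) (Q : pred I) (X : I -> T -> R) :
  (forall i, all_moments (X i)) -> all_moments (fun w => \prod_(i <- s | Q i) X i w).
Proof.
move=> aX; elim: s => [|i s IH].
  by under eq_fun do rewrite big_nil; exact: all_moments_cst.
under eq_fun do rewrite big_cons; case: (Q i) => //.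
exact: all_momentsM.
Qed.

Lemma all_momentsX X k : all_moments X -> all_moments (fun w => X w ^+ k).
Proof.
move=> aX; elim: k => [|k IH]; first by under eq_fun do rewrite expr0; exact: all_moments_cst.
by under eq_fun do rewrite exprS; exact: all_momentsM.
Qed.

Lemma Rintegral_sum (I : Type) (s : seq I) (Q : pred I) (X : I -> T -> R) :
  (forall i, all_moments (X i)) ->
  \int[P]_w (\sum_(i <- s | Q i) X i w) = \sum_(i <- s | Q i) \int[P]_w X i w.
Proof.
move=> aX; elim: s => [|i s IH].
  rewrite big_nil; under eq_Rintegral do rewrite big_nil.
  by rewrite Rintegral_cst// mul0r.
rewrite big_cons; under eq_Rintegral do rewrite big_cons.
case: (Q i) => //; rewrite RintegralD ?IH//; apply: all_moments_integrable => //.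
exact: all_moments_sum.
Qed.

End Moments.

(** * Moments of exchangeable variables and of their centered versions *)

Section ExchangeableMoments.
Context d (T : measurableType d) (R : realType) (P : probability T R).
Variable xi : nat -> {RV P >-> R}.
Hypothesis xi_exch : exchangeable xi.
Hypothesis xi_mom : forall i, finite_moments (xi i).

Lemma all_moments_xi i : all_moments P (xi i).
Proof. by split=> //; exact: xi_mom. Qed.

(** Both sides are integrals of [phi] against image measures on tuples, and exchangeability says
    that these measures agree. *)
Lemma exchangeable_expectation n (s : 'S_n) (phi : n.-tuple R -> R) :
  measurable_fun setT phi ->
  P.-integrable setT (EFin \o (fun w => phi [tuple xi i w | i < n])) ->
  P.-integrable setT (EFin \o (fun w => phi [tuple xi (s i) w | i < n])) ->
  \int[P]_w phi [tuple xi i w | i < n] = \int[P]_w phi [tuple xi (s i) w | i < n].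
Proof.
move=> mphi i1 i2.
have mf (g : 'I_n -> nat) : measurable_fun setT (fun w => [tuple xi (g i) w | i < n]).
  apply/measurable_fun_tnthP => i;
  apply: (eq_measurable_fun (xi (g i))) => // w _ /=.
  by rewrite tnth_mktuple.
have mphi' : measurable_fun setT (EFin \o phi) by exact/measurable_EFinP.
have /= e1 := integral_pushforward (mf (@nat_of_ord n)) mphi' i1 measurableT.
have /= e2 := integral_pushforward (mf (fun i => s i)) mphi' i2 measurableT.
rewrite /Rintegral; congr fine.
transitivity (\int[P]_(x in [set: T]) (phi [tuple xi i x | i < n])%:E)%E => //.
rewrite -[LHS]e1 -[RHS]e2; apply: eq_measure_integral => A mA _.
exact: xi_exch.
Qed.

(** Centering by the mean of the first [n] variables, rather than by its limit, makes the first [n]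
    centered variables sum to zero exactly. *)
Definition centered n i w : R := xi i w - empirical_mean xi n w.

Lemma all_moments_mean n : all_moments P (empirical_mean xi n).
Proof.
rewrite /empirical_mean; apply: all_momentsM; first exact: all_moments_cst.
by apply: all_moments_sum => i; exact: all_moments_xi.
Qed.

Lemma all_moments_centered n i : all_moments P (centered n i).
Proof.
by apply: all_momentsB; [exact: all_moments_xi|exact: all_moments_mean].
Qed.

Lemma sum_centered n w : \sum_(i < n) centered n i w = 0.
Proof.
case: n => [|n]; first by rewrite big_ord0.
rewrite /centered sumrB sumr_const card_ord /empirical_mean.
by rewrite -[X in _ - X]mulr_natl mulrA divff ?pnatr_eq0// mul1r subrr.
Qed.

(** Permuting the first [n] variables does not change their mean, so the centered variables inherit
    exchangeability. *)
Lemma centered_prod_perm n (s : 'S_n) (c : seq 'I_n) :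
  \int[P]_w (\prod_(i <- c) centered n i w) =
  \int[P]_w (\prod_(i <- c) centered n (s i) w).
Proof.
pose phi (x : n.-tuple R) :=
  \prod_(i <- c) (tnth x i - n%:R^-1 * \sum_(j < n) tnth x j).
have phi1 w : phi [tuple xi i w | i < n] = \prod_(i <- c) centered n i w.
  apply: eq_bigr => i _; rewrite tnth_mktuple /centered; congr (_ - _ * _).
  by apply: eq_bigr => j _; rewrite tnth_mktuple.
have phi2 w : phi [tuple xi (s i) w | i < n] = \prod_(i <- c) centered n (s i) w.
  apply: eq_bigr => i _; rewrite tnth_mktuple /centered; congr (_ - _ * _).
  rewrite [RHS](reindex_inj (@perm_inj _ s))/=.
  by apply: eq_bigr => j _; rewrite tnth_mktuple.
under eq_Rintegral do rewrite -phi1.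
under [RHS]eq_Rintegral do rewrite -phi2.
apply: exchangeable_expectation.
- apply: measurable_prod => i _; apply: measurable_funB; first exact: measurable_tnth.
  by apply: measurable_funM => //; apply: measurable_sum => j; exact: measurable_tnth.
- apply: all_moments_integrable; under eq_fun do rewrite phi1.
  by apply: all_moments_prod => i; exact: all_moments_centered.
- apply: all_moments_integrable; under eq_fun do rewrite phi2.
  by apply: all_moments_prod => i; exact: all_moments_centered.
Qed.

Lemma xi_moment_eq i p : \int[P]_w (xi i w ^+ p) = \int[P]_w (xi 0%N w ^+ p).
Proof.
pose s : 'S_i.+1 := tperm ord0 ord_max.
pose phi (x : i.+1.-tuple R) := tnth x ord0 ^+ p.
have -> : \int[P]_w (xi 0%N w ^+ p) = \int[P]_w phi [tuple xi j w | j < i.+1].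
  by apply: eq_Rintegral => w _; rewrite /phi tnth_mktuple.
have -> : \int[P]_w (xi i w ^+ p) = \int[P]_w phi [tuple xi (s j) w | j < i.+1].
  by apply: eq_Rintegral => w _; rewrite /phi tnth_mktuple /s tpermL.
apply/esym/exchangeable_expectation.
- by apply: measurable_funX; exact: measurable_tnth.
- apply: all_moments_integrable; under eq_fun do rewrite /phi tnth_mktuple.
  by apply: all_momentsX; exact: all_moments_xi.
- apply: all_moments_integrable; under eq_fun do rewrite /phi tnth_mktuple.
  by apply: all_momentsX; exact: all_moments_xi.
Qed.

(** Bounds the moment of order [2 * p] of the centered variables uniformly in [n] and [i]; the power
    of [2] pays for splitting the difference. *)
Definition moment_bound p : R := 2 ^+ (2 * p) * \int[P]_w (xi 0%N w ^+ (2 * p)).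

Lemma moment_bound_ge0 p : 0 <= moment_bound p.
Proof.
by rewrite mulr_ge0 ?exprn_ge0// Rintegral_ge0// => w _; rewrite exprM exprn_ge0 ?sqr_ge0.
Qed.

(** By convexity the mean has no larger even moments than [xi 0]. Splitting the difference into its
    two terms costs [2 ^+ (2 * p).-1], once for each of them. *)
Lemma centered_moment_le n i p : (0 < p)%N ->
  \int[P]_w (centered n i w ^+ (2 * p)) <= moment_bound p.
Proof.
move=> p0; set q := (2 * p)%N; set m := \int[P]_w (xi 0%N w ^+ q).
have m0 : 0 <= m.
  by apply: Rintegral_ge0 => w _; rewrite exprM exprn_ge0 ?sqr_ge0.
have mean_le : \int[P]_w (empirical_mean xi n w ^+ q) <= m.
  apply: (@le_trans _ _ (\int[P]_w (n%:R^-1 * \sum_(j < n) xi j w ^+ q))).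
    apply: le_Rintegral => //.
    - by apply: all_moments_integrable; apply: all_momentsX; exact: all_moments_mean.
    - apply: all_moments_integrable; apply: all_momentsM; first exact: all_moments_cst.
      by apply: all_moments_sum => j; apply: all_momentsX; exact: all_moments_xi.
    move=> w _; rewrite /empirical_mean exprMn.
    case: n => [|n]; first by rewrite invr0 !mul0r expr0n muln_eq0/= eqn0Ngt p0 mul0r.
    apply: le_trans (ler_wpM2l _ (power_mean_even _ p0)) _; first by rewrite exprn_ge0.
    rewrite -/q; have -> : q = q.-1.+1 by rewrite prednK// muln_gt0.
    rewrite [leLHS](_ : _ = n.+1%:R^-1 * \sum_(j < n.+1) xi j w ^+ q.-1.+1)//.
    by rewrite exprS exprVn -mulrA mulKf// expf_neq0// pnatr_eq0.
  rewrite RintegralZl//; last first.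
    apply: all_moments_integrable; apply: all_moments_sum => j.
    by apply: all_momentsX; exact: all_moments_xi.
  rewrite Rintegral_sum; last by move=> j; apply: all_momentsX; exact: all_moments_xi.
  under eq_bigr do rewrite xi_moment_eq.
  rewrite sumr_const card_ord -/m -[m *+ n]mulr_natl mulrA.
  by case: n => [|n]; rewrite ?mulr0 ?mul0r// mulVf ?pnatr_eq0// mul1r.
apply: (@le_trans _ _ (\int[P]_w
    (2 ^+ q.-1 * (xi i w ^+ q + empirical_mean xi n w ^+ q)))).
  apply: le_Rintegral => //.
  - by apply: all_moments_integrable; apply: all_momentsX; exact: all_moments_centered.
  - apply: all_moments_integrable; apply: all_momentsM; first exact: all_moments_cst.
    by apply: all_momentsD; apply: all_momentsX; [exact: all_moments_xi|exact: all_moments_mean].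
  move=> w _; rewrite /centered.
  have := power_mean_even (fun j : 'I_2 => if j == 0 then xi i w else - empirical_mean xi n w) p0.
  rewrite !big_ord_recl !big_ord0/= !addr0 => /le_trans; apply.
  by rewrite [(- _) ^+ _]exprM sqrrN -exprM.
rewrite RintegralZl//; last first.
  apply: all_moments_integrable; apply: all_momentsD; apply: all_momentsX;
    [exact: all_moments_xi|exact: all_moments_mean].
rewrite RintegralD//; first last.
- by apply: all_moments_integrable; apply: all_momentsX; exact: all_moments_mean.
- by apply: all_moments_integrable; apply: all_momentsX; exact: all_moments_xi.
rewrite xi_moment_eq -/m /moment_bound -/m -/q.
have -> : 2 ^+ q = 2 * 2 ^+ q.-1 :> R by rewrite -exprS prednK// muln_gt0.
have : 0 <= 2 ^+ q.-1 :> R by rewrite exprn_ge0.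
by move: (2 ^+ _ : R) => t t0; nra.
Qed.

(** Pointwise the product is at most a sum of [2 * p] powers of single variables, each with
    expectation at most [moment_bound p]. *)
Lemma centered_prod_le n (c : seq 'I_n) p : (0 < p)%N -> size c = (2 * p)%N ->
  `|\int[P]_w (\prod_(i <- c) centered n i w)| <= (2 * p)%:R * moment_bound p.
Proof.
move=> p0 cp.
have mom i := all_momentsX (2 * p) (all_moments_centered n i).
have momp : all_moments P (fun w => \prod_(i <- c) centered n (nat_of_ord i) w).
  by apply: all_moments_prod => i; exact: all_moments_centered.
apply: le_trans (le_normr_Rintegral _ _) _ => //.
  exact: all_moments_integrable.
apply: (@le_trans _ _ (\int[P]_w (\sum_(i <- c) centered n i w ^+ (2 * p)))).
  apply: le_Rintegral => //.
  - by apply: integrable_norm; exact: all_moments_integrable.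
  - by apply: all_moments_integrable; apply: all_moments_sum => i.
  move=> w _; rewrite normr_prod.
  apply: le_trans (prod_le_sum_power _ _) _ => //.
    by rewrite cp muln_gt0.
  by rewrite cp ler_sum// => i _; rewrite expr_even_norm.
rewrite Rintegral_sum//.
apply: (@le_trans _ _ (\sum_(i <- c) moment_bound p)).
  by apply: ler_sum => i _; exact: centered_moment_le.
by rewrite big_const_seq count_predT cp iter_addr_0 mulr_natl.
Qed.

(* Exchangeability makes [E (eta_i * prod_c eta)] independent of the choice of
   [i] outside [c], while the sum over all [i] vanishes. *)
Lemma centered_prod_single_le n (a : 'I_n) (c : seq 'I_n) p :
  (0 < p)%N -> (size c).+1 = (2 * p)%N -> a \notin c -> (2 * p < n)%N ->
  `|\int[P]_w (\prod_(i <- a :: c) centered n i w)| <=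
  (2 * p)%:R ^+ 2 * moment_bound p / (n - 2 * p)%:R.
Proof.
move=> p0 cp ac pn.
set mu := \int[P]_w _; pose e (i : 'I_n) := \int[P]_w (\prod_(j <- i :: c) centered n j w).
have eE i : i \notin c -> e i = mu.
  move=> ic; rewrite /e /mu (centered_prod_perm (tperm a i) (a :: c)).
  apply: eq_Rintegral => w _; rewrite !big_cons tpermL; congr (_ * _).
  rewrite !big_seq; apply: eq_bigr => j jc; rewrite tpermD//.
    by apply: contraNneq ac => ->.
  by apply: contraNneq ic => ->.
have sum_e : \sum_i e i = 0.
  rewrite /e -Rintegral_sum; last first.
    by move=> i; apply: all_moments_prod => j; exact: all_moments_centered.
  transitivity (\int[P]_w (0 : R)); last by rewrite Rintegral_cst// mul0r.
  apply: eq_Rintegral => w _; under eq_bigr do rewrite big_cons.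
  by rewrite -mulr_suml sum_centered mul0r.
(* The vanishing sum is split: each index outside [c] contributes [mu], and the others go to the
   right-hand side. *)
have : #|[predC c]|%:R * mu = - \sum_(i in c) e i.
  apply/eqP; rewrite -addr_eq0 addrC -[X in _ == X]sum_e.
  rewrite [X in _ == X](bigID [in c])/=; apply/eqP; congr (_ + _).
  rewrite [RHS](eq_bigr (fun=> mu)); last by move=> i /eE.
  by rewrite sumr_const mulr_natl.
move=> /(congr1 Num.norm); rewrite normrM normr_nat normrN => mu_e.
have B0 := moment_bound_ge0 p.
(* Fewer than [2 * p] indices lie in [c], each with the generic bound; this yields the square of
   [2 * p]. *)
have sumle : `|\sum_(i in c) e i| <= (2 * p)%:R ^+ 2 * moment_bound p.
  apply: le_trans (ler_norm_sum _ _ _) _.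
  apply: (@le_trans _ _ (\sum_(i in c) (2 * p)%:R * moment_bound p)).
    by apply: ler_sum => i _; exact: centered_prod_le.
  rewrite sumr_const -[leLHS]mulr_natl expr2 mulrA ler_wpM2r// ler_wpM2r// ler_nat.
  by apply: leq_trans (card_size c) _; rewrite -cp.
rewrite ler_pdivlMr ?ltr0n ?subn_gt0// mulrC.
apply: le_trans sumle; rewrite -mu_e ler_wpM2r// ler_nat.
rewrite leq_subLR -[leqLHS]card_ord -(cardC (mem c)) leq_add2r.
by apply: leq_trans (card_size c) _; rewrite -cp.
Qed.

End ExchangeableMoments.

(** * Even moments of sums of products of two centered variables *)

Section PairSums.

(** When a power of a sum is expanded over maps [f] from factors to summation indices, these [f]
    give the monomials with a variable that occurs exactly once. *)
Definition has_single (I J : finType) (f : {ffun I -> J}) :=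
  [exists t, forall t', (f t' == f t) ==> (t' == t)].

(* If every value is hit at least twice then the image has at most [k]
   elements, so [f] factors through ['I_k]. *)
Lemma card_no_single (k m : nat) : (0 < k)%N ->
  (#|[set f : {ffun 'I_(2 * k) -> 'I_m} | ~~ has_single f]%SET| <=
   k ^ (2 * k) * m ^ k)%N.
Proof.
case: k => // k _; set K := (2 * k.+1)%N.
pose G (gh : {ffun 'I_K -> 'I_k.+1} * {ffun 'I_k.+1 -> 'I_m}) : {ffun 'I_K -> 'I_m} :=
  [ffun t => gh.2 (gh.1 t)].
have -> : (k.+1 ^ K * m ^ k.+1 =
    #|[set: {ffun 'I_K -> 'I_k.+1} * {ffun 'I_k.+1 -> 'I_m}]%SET|)%N.
  by rewrite cardsT card_prod !card_ffun !card_ord.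
apply: leq_trans (leq_imset_card G _).
apply: subset_leq_card; apply/fintype.subsetP => f; rewrite inE => nsf.
pose S := [set f t | t : 'I_K]%SET.
have fS t : f t \in S by apply: imset_f.
have cardS : (#|S| <= k.+1)%N.
  rewrite -(@leq_pmul2l 2)// -/K -[leqRHS]card_ord -[leqRHS]sum1_card.
  rewrite (partition_big f (mem S))//=.
  rewrite mulnC -sum_nat_const; apply: leq_sum => y /imsetP[t _ ->].
  rewrite sum1_card.
  move: nsf; rewrite negb_exists => /forallP/(_ t).
  rewrite negb_forall => /existsP[t']; rewrite negb_imply => /andP[ft' tt'].
  have <- : #|[set t'; t]%SET| = 2%N by rewrite cards2 tt'.
  apply: subset_leq_card; apply/fintype.subsetP => u.
  by rewrite !inE => /orP[]/eqP->; rewrite unfold_in/=; do ?exact: eqxx.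
have y0 : 'I_m by exact: (f ord0).
(* The map is factored through the positions in an enumeration of [S]; they are below
   [#|S| <= k.+1], so [inord] keeps them unchanged. *)
apply/imsetP; exists ([ffun t => inord (index (f t) (enum S))],
  [ffun i : 'I_k.+1 => nth y0 (enum S) i]) => //.
apply/ffunP => t; rewrite !ffunE/= inordK.
  by rewrite nth_index// mem_enum.
by apply: leq_trans cardS; rewrite cardE index_mem mem_enum.
Qed.

Context d (T : measurableType d) (R : realType) (P : probability T R).
Variable xi : nat -> {RV P >-> R}.
Hypothesis xi_exch : exchangeable xi.
Hypothesis xi_mom : forall i, finite_moments (xi i).
Local Notation eta := (centered xi).

(** A monomial of the power [2 * k] of a pair sum has [4 * k] factors, so this is the constant of
    [centered_prod_single_le] at [p = 2 * k]; it also dominates that of [centered_prod_le]. *)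
Definition pair_sum_const (k : nat) : R :=
  (4 * k)%:R ^+ 2 * moment_bound xi (2 * k).

Lemma pair_sum_const_ge0 k : 0 <= pair_sum_const k.
Proof. by rewrite mulr_ge0 ?exprn_ge0// moment_bound_ge0. Qed.

(** The power is expanded over maps [f]. Those without a single value are few, at most
    [k ^ (2 * k) * m ^ k], and get the generic bound; the others may number [m ^ (2 * k)] but each
    gains the factor [1 / (n - 4 * k)]. *)
Lemma pair_sum_moment_le n m k (a b : 'I_m -> 'I_n) :
  (0 < k)%N -> (4 * k < n)%N -> injective a -> injective b ->
  (forall l l', a l != b l') ->
  \int[P]_w ((\sum_(l < m) eta n (a l) w * eta n (b l) w) ^+ (2 * k)) <=
  pair_sum_const k * ((k ^ (2 * k) * m ^ k)%:R + (m ^ (2 * k))%:R / (n - 4 * k)%:R).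
Proof.
move=> k0 kn inja injb ab.
(* The indices of the variables in the monomial of [f], with multiplicity. *)
pose c (f : {ffun 'I_(2 * k) -> 'I_m}) :=
  [seq a (f t) | t <- enum 'I_(2 * k)] ++ [seq b (f t) | t <- enum 'I_(2 * k)].
have size_c f : size (c f) = (2 * (2 * k))%N.
  by rewrite size_cat !size_map -!enumT !size_enum_ord; lia.
have momc (s : seq 'I_n) : all_moments P (fun w => \prod_(i <- s) eta n i w).
  by apply: all_moments_prod => i; exact: all_moments_centered.
have -> : \int[P]_w ((\sum_(l < m) eta n (a l) w * eta n (b l) w) ^+ (2 * k)) =
    \sum_(f : {ffun 'I_(2 * k) -> 'I_m}) \int[P]_w (\prod_(i <- c f) eta n i w).
  rewrite -Rintegral_sum//; apply: eq_Rintegral => w _.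
  rewrite -[in LHS](card_ord (2 * k)) -prodr_const bigA_distr_bigA/=.
  apply: eq_bigr => f _.
  by rewrite /c big_cat !big_map/= -!enumT !big_enum/= -big_split.
have C0 : (0 : R) < (n - 4 * k)%:R by rewrite ltr0n subn_gt0.
have K0 : (0 < 2 * k)%N by rewrite muln_gt0.
have gen f : `|\int[P]_w (\prod_(i <- c f) eta n i w)| <= pair_sum_const k.
  apply: le_trans (centered_prod_le xi_exch xi_mom K0 (size_c f)) _.
  rewrite /pair_sum_const ler_wpM2r ?moment_bound_ge0//.
  by rewrite -natrX ler_nat; nia.
have single f : has_single f ->
    `|\int[P]_w (\prod_(i <- c f) eta n i w)| <= pair_sum_const k / (n - 4 * k)%:R.
  move=> /existsP[t0 /forallP t0P].
  have ac : a (f t0) \in c f.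
    by rewrite mem_cat map_f// mem_enum.
  (* Injectivity of [a] excludes a repetition among the first halves, and disjointness from [b] one
     among the second halves. *)
  have cnt : count_mem (a (f t0)) (c f) = 1%N.
    rewrite count_cat !count_map.
    rewrite [X in (_ + X)%N](_ : _ = 0)%N; last first.
      apply/eqP; rewrite -leqn0 leqNgt -has_count; apply/hasPn => t _ /=.
      by rewrite eq_sym ab.
    rewrite addn0 (@eq_in_count _ _ (pred1 t0)).
      by rewrite -enumT count_uniq_mem ?enum_uniq// mem_enum.
    move=> t _ /=; rewrite (inj_eq inja); apply/idP/eqP => [|->//].
    by move=> /(implyP (t0P t))/eqP.
  have pc := perm_to_rem ac.
  under eq_Rintegral do rewrite (perm_big _ pc).
  rewrite /pair_sum_const; have -> : (4 * k = 2 * (2 * k))%N by lia.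
  apply: centered_prod_single_le => //.
  - by rewrite size_rem// size_c prednK// muln_gt0.
  - apply/count_memPn; have /seq.permP/(_ (pred1 (a (f t0)))) := pc.
    by rewrite cnt /= eqxx => -[].
  - lia.
apply: (@le_trans _ _ (\sum_(f : {ffun 'I_(2 * k) -> 'I_m})
  `|\int[P]_w (\prod_(i <- c f) eta n i w)|)).
  by apply: ler_sum => f _; exact: ler_norm.
rewrite (bigID (fun f => ~~ has_single f))/= mulrDr; apply: lerD.
  apply: (@le_trans _ _ (\sum_(f : {ffun 'I_(2 * k) -> 'I_m} | ~~ has_single f)
      pair_sum_const k)); first by apply: ler_sum => f _.
  rewrite sumr_const -[leLHS]mulr_natr ler_wpM2l ?pair_sum_const_ge0// ler_nat.
  by have := card_no_single m k0; rewrite cardsE.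
apply: (@le_trans _ _ (\sum_(f : {ffun 'I_(2 * k) -> 'I_m} | ~~ ~~ has_single f)
      (pair_sum_const k / (n - 4 * k)%:R))).
  by apply: ler_sum => f; rewrite negbK => /single.
rewrite sumr_const -[leLHS]mulr_natr mulrAC -mulrA ler_wpM2l ?pair_sum_const_ge0//.
rewrite ler_wpM2r ?invr_ge0// ler_nat.
by apply: leq_trans (max_card _) _; rewrite card_ffun !card_ord.
Qed.

End PairSums.

(** * Band matrices *)

Section BandGeometry.

(** The properties through which both distances enter the probabilistic part. The triangle
    inequality confines the Gram matrix of a band matrix to a band of twice the half-width. *)
Definition band_geometry (dist : nat -> nat -> nat -> nat) := forall N : nat,
  [/\ forall i j, dist N i j = dist N j i,
      forall i j l : 'I_N, (dist N i j <= dist N i l + dist N l j)%N &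
      forall (i : 'I_N) c, (#|[set j : 'I_N | dist N i j <= c]%SET| <= minn N (2 * c + 1))%N].

Lemma card_le_inj_ord n m (A : {set 'I_n}) (f : 'I_n -> nat) :
  (forall i, i \in A -> (f i < m)%N) -> {in A &, injective f} -> (#|A| <= m)%N.
Proof.
case: m => [|m] fm injf.
  case: (set_0Vmem A) => [->|[i /fm]//]; by rewrite cards0.
rewrite -[leqRHS]card_ord -(card_in_imset (f := fun i => inord (f i) : 'I_m.+1)).
  exact: max_card.
by move=> i j iA jA /(congr1 val)/=; rewrite !inordK ?fm// => /injf; apply.
Qed.

Lemma card_ge_inj_ord n m (A : {set 'I_n}) (f : nat -> nat) :
  (forall t, (t < m)%N -> (f t < n)%N) ->
  (forall t (i : 'I_n), (t < m)%N -> i = f t :> nat -> i \in A) ->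
  (forall t u, (t < m)%N -> (u < m)%N -> f t = f u -> t = u) -> (m <= #|A|)%N.
Proof.
case: n A => [|n] A fn fA injf.
  by case: m fn {fA injf} => // m /(_ 0%N (ltn0Sn _)).
rewrite -[leqLHS]card_ord -(card_imset (f := fun t : 'I_m => inord (f t) : 'I_n.+1)).
  apply/subset_leq_card/fintype.subsetP => _ /imsetP[t _ ->].
  by apply: (fA t) => //; rewrite /= inordK// fn.
by move=> t u /(congr1 val)/=; rewrite !inordK ?fn// => /injf /= tu; apply/val_inj/tu.
Qed.

Lemma strict_geometry : band_geometry strict_dist.
Proof.
rewrite /strict_dist => N; split=> [i j|i j l|i c]; [lia|lia|].
rewrite leq_min; apply/andP; split.
  by rewrite -[leqRHS]card_ord; exact: max_card.
apply: (@card_le_inj_ord _ _ _ (fun j : 'I_N => (j + c - i)%N)) => [j|j l].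
  rewrite inE; lia.
by rewrite !inE => ? ? ?; apply: val_inj => /=; lia.
Qed.

Lemma periodic_geometry : band_geometry periodic_dist.
Proof.
rewrite /periodic_dist => N; split=> [i j|i j l|i c].
- lia.
- by have := ltn_ord i; have := ltn_ord j; have := ltn_ord l; lia.
rewrite leq_min; apply/andP; split.
  by rewrite -[leqRHS]card_ord; exact: max_card.
have [Nc|cN] := leqP N (2 * c + 1).
  by apply: leq_trans Nc; rewrite -[leqRHS]card_ord; exact: max_card.
(* [f j] is the offset, shifted by [c], of the representative of [j] modulo [N] that lies within [c]
   of [i]; it is unique as [2 * c + 1 < N]. *)
pose f (j : 'I_N) := (if `|i - j|%N <= c then j + c - i
  else if j < i then j + N - i + c else j + c - N - i)%N.
have iN := ltn_ord i.
apply: (@card_le_inj_ord _ _ _ f) => [j|j l]; rewrite /f.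
  by rewrite inE; have := ltn_ord j; repeat (case: ifPn => ?); lia.
rewrite !inE => jc lc jl; apply: val_inj => /=; move: jc lc jl.
by have := ltn_ord j; have := ltn_ord l;
  repeat (case: ifPn => ?); lia.
Qed.

Lemma periodic_row_card N b (i : 'I_N) :
  (minn N (2 * b + 1) <= #|[set j : 'I_N | periodic_dist N i j <= b]%SET|)%N.
Proof.
rewrite /periodic_dist; have iN := ltn_ord i.
have [Nb|bN] := leqP N (2 * b + 1).
  apply: (@card_ge_inj_ord _ _ _ id) => // [t j tN jt]; rewrite inE.
  have := ltn_ord j; lia.
(* [f t] is [i + t - b] reduced modulo [N], which runs through the cyclic interval around [i]. *)
pose f t := (if i + t < b then i + t + N - b else
  if N + b <= i + t then i + t - b - N else i + t - b)%N.
apply: (@card_ge_inj_ord _ _ _ f); rewrite /f.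
- by move=> t tb; repeat (case: ifPn => ?); lia.
- move=> t j tb; rewrite inE geq_min; have := ltn_ord j.
  by repeat (case: ifPn => ?); move=> ? ?; apply/orP; first [left; lia|right; lia].
- by move=> t u tb ub; repeat (case: ifPn => ?); lia.
Qed.

Lemma strict_row_card N b (i : 'I_N) :
  (minn i b + minn (N - 1 - i) b + 1 <=
   #|[set j : 'I_N | strict_dist N i j <= b]%SET|)%N.
Proof.
rewrite /strict_dist; have iN := ltn_ord i.
(* The truncated [i - b] is the leftmost neighbour of [i], also when the band is cut off at [0]. *)
apply: (@card_ge_inj_ord _ _ _ (fun t => t + (i - b))%N) => [t|t j|t u]; rewrite ?inE; lia.
Qed.

(** Doubled to avoid a halving in the naturals. The induction on [N] adds a term [b] as long as [b]
    stays below; the boundary case is the sum of the first integers. *)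
Lemma sum_minn N b : (b <= N)%N ->
  (2 * \sum_(i < N) minn i b = b * (2 * N - b - 1))%N.
Proof.
elim: N => [|N IH]; first by rewrite leqn0 => /eqP->; rewrite big_ord0.
rewrite leq_eqVlt ltnS => /predU1P[->|bN].
  have -> : (\sum_(i < N.+1) minn i N.+1 = \sum_(i < N.+1) i)%N.
    by apply: eq_bigr => i _; apply/minn_idPl/ltnW.
  rewrite -(big_mkord xpredT id) bin2_sum; have := mul_bin_diag N.+1 1; rewrite bin1; lia.
by rewrite big_ord_recr/= mulnDr IH// (minn_idPr bN); nia.
Qed.

Lemma strict_card N b : (b < N)%N ->
  (N + b * (2 * N - b - 1) <=
   \sum_(i < N) #|[set j : 'I_N | strict_dist N i j <= b]%SET|)%N.
Proof.
move=> bN; apply: (@leq_trans (\sum_(i < N) (minn i b + minn (N - 1 - i) b + 1))).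
  rewrite !big_split/= sum1_card card_ord addnC leq_add2r.
  (* Reflecting the indices exchanges left and right neighbours. *)
  have -> : (\sum_(i < N) minn (N - 1 - i) b = \sum_(i < N) minn i b)%N.
    rewrite (reindex_inj rev_ord_inj)/=; apply: eq_bigr => i _.
    by have iN := ltn_ord i; rewrite (_ : (N - 1 - (N - i.+1))%N = i)//; lia.
  by rewrite -(sum_minn (ltnW bN)) mul2n addnn.
by apply: leq_sum => i _; exact: strict_row_card.
Qed.

End BandGeometry.

(** * Operator norms of band matrices *)

Section BandMatrices.
Variable R : realType.

Lemma bandwidth_gt0 (b : nat -> nat) N : (0 < N)%N -> (0 < bandwidth b N)%N.
Proof. by rewrite /bandwidth; lia. Qed.

Definition band_mx (dist : nat -> nat -> nat -> nat) (b : nat -> nat) (N : nat) : 'M[R]_N :=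
  \matrix_(i, j) (dist N i j <= b N)%N%:R.

Variables (dist : nat -> nat -> nat -> nat) (b : nat -> nat).
Hypothesis geom : band_geometry dist.

(** The half-width [c] is independent of [b N] because it is used for the band itself and for the
    doubled band of the Gram matrix. *)
Lemma sum_band_le N (i : 'I_N) c (F : 'I_N -> R) (K : R) : 0 <= K ->
  (forall j : 'I_N, (dist N i j <= c)%N -> F j <= K) ->
  (forall j : 'I_N, (c < dist N i j)%N -> F j <= 0) ->
  \sum_j F j <= (minn N (2 * c + 1))%:R * K.
Proof.
move=> K0 FK F0; have [_ _ card_le] := geom N.
have le_sum : \sum_j F j <= \sum_(j in [set j : 'I_N | (dist N i j <= c)%N]%SET) K.
  rewrite [leRHS]big_mkcond/=; apply: ler_sum => j _.
  by rewrite inE; case: leqP => [/FK|/F0].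
apply: le_trans le_sum _.
by rewrite sumr_const -[leLHS]mulr_natl ler_wpM2r// ler_nat.
Qed.

(** A row sum of the Gram matrix counts two successive steps inside the band, each with at most [w]
    choices. *)
Lemma opnorm_band_mx_le N : opnorm (band_mx dist b N) <= (bandwidth b N)%:R.
Proof.
have [sym _ _] := geom N.
set w : R := (bandwidth b N)%:R; have w0 : 0 <= w by [].
apply: opnorm_le => // x.
rewrite -[w](ger0_norm w0) -sqrtr_sqr; apply: l2norm_mulmx_le; first exact: sqr_ge0.
move=> i.
have -> : \sum_j `|\sum_l band_mx dist b N l i * band_mx dist b N l j| =
    \sum_(l < N) (dist N l i <= b N)%N%:R * \sum_(j < N) (dist N l j <= b N)%N%:R.
  rewrite (eq_bigr (fun j => \sum_l band_mx dist b N l i * band_mx dist b N l j)); last first.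
    by move=> j _; rewrite ger0_norm ?sumr_ge0// => l _; rewrite !mxE mulr_ge0.
  rewrite exchange_big/=; apply: eq_bigr => l _.
  by rewrite mulr_sumr; apply: eq_bigr => j _; rewrite !mxE.
have row (l : 'I_N) : \sum_(j < N) (dist N l j <= b N)%N%:R <= w.
  rewrite -[w]mulr1; apply: (sum_band_le (i := l)) => // j.
    by move=> ->.
  by rewrite ltnNge => /negbTE->.
rewrite expr2; apply: (sum_band_le (i := i)) => // l; rewrite sym.
  by move=> ->; rewrite mul1r.
by rewrite ltnNge => /negbTE->; rewrite mul0r.
Qed.

(** Schur's test for the Gram matrix of [Y], with [h] bounding squared entries and [s] the
    off-diagonal Gram entries stripped of the terms [l = i] and [l = j]. *)
Lemma opnorm_band_le N (Y : 'M[R]_N) (h s : R) : 0 <= h -> 0 <= s ->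
  (forall i j : 'I_N, (b N < dist N i j)%N -> Y i j = 0) ->
  (forall i j, Y i j ^+ 2 <= h) ->
  (forall i j, i != j ->
     `|\sum_(l | (l != i) && (l != j)) Y l i * Y l j| <= s) ->
  opnorm Y <= Num.sqrt ((bandwidth b N)%:R * (5 * h + 2 * s)).
Proof.
move=> h0 s0 Yband Yh Ys; have [sym tri _] := geom N.
set w : R := (bandwidth b N)%:R; have w0 : 0 <= w by [].
apply: opnorm_le => [|x]; first exact: sqrtr_ge0.
apply: l2norm_mulmx_le => [|i]; first by rewrite mulr_ge0// addr_ge0// mulr_ge0.
have Yhh l i1 j1 : `|Y l i1 * Y l j1| <= h.
  rewrite normrM; have := Yh l i1; have := Yh l j1.
  rewrite -(@real_normK _ (Y l i1)) ?num_real// -(@real_normK _ (Y l j1)) ?num_real//.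
  have := sqr_ge0 (`|Y l i1| - `|Y l j1|); rewrite sqrrB; lra.
rewrite (bigD1 i)//=.
(* The diagonal Gram entry is at most [w * h]; at most [2 * w] others are nonzero, each bounded by
   [s] plus [h] for either stripped term. *)
have -> : w * (5 * h + 2 * s) = w * h + (2 * w) * (s + 2 * h) by ring.
apply: lerD.
  apply: le_trans (ler_norm_sum _ _ _) _.
  apply: (sum_band_le (i := i)) => // l; rewrite sym => il.
  by rewrite Yband// mul0r normr0.
apply: (@le_trans _ _ ((minn N (2 * (2 * b N) + 1))%:R * (s + 2 * h))); last first.
  rewrite ler_wpM2r ?addr_ge0 ?mulr_ge0// /w -natrM ler_nat /bandwidth; lia.
rewrite big_mkcond/=; apply: (sum_band_le (i := i)) => [|j ij|j ij].
- by rewrite addr_ge0 ?mulr_ge0.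
- case: eqVneq => [_|nij]; first by rewrite addr_ge0 ?mulr_ge0.
  rewrite (bigD1 i)//= (bigD1 j)//=.
  apply: le_trans (ler_normD _ _) _.
  apply: le_trans (lerD (Yhh _ _ _) (ler_normD _ _)) _.
  have := Yhh j i j; have := Ys i j; rewrite eq_sym nij => /(_ isT); lra.
- case: eqVneq => // nij; rewrite big1 ?normr0// => l _.
  have [li|li] := leqP (dist N l i) (b N); last by rewrite Yband ?mul0r.
  rewrite [Y l j]Yband ?mulr0//.
  by have := tri i j l; rewrite (sym i l); lia.
Qed.

End BandMatrices.

(** * Almost sure convergence *)

Section AlmostSureConvergence.
Context d (T : measurableType d) (R : realType) (P : probability T R).

(** The sum telescopes. *)
Lemma sum_inv_mul_succ_le n :
  \sum_(i < n) ((i.+1%:R * i.+2%:R)^-1 : R) <= 1.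
Proof.
suff -> : \sum_(i < n) ((i.+1%:R * i.+2%:R)^-1 : R) = 1 - n.+1%:R^-1.
  by rewrite gerBl invr_ge0.
elim: n => [|n IH]; first by rewrite big_ord0 invr1 subrr.
rewrite big_ord_recr/= IH.
have n1 : n.+1%:R != 0 :> R by rewrite pnatr_eq0.
have n2 : n.+2%:R != 0 :> R by rewrite pnatr_eq0.
have e : n.+2%:R = n.+1%:R + 1 :> R by rewrite natr1.
by move: n2; rewrite e; move: n1; move: (n.+1%:R : R) => a a0 a1; field; apply/andP.
Qed.

(** The sum of all [Q n] has finite expectation by monotone convergence, hence is finite almost
    everywhere, and the terms of a convergent series tend to zero. *)
Lemma ae_cvg0_summable (Q : nat -> T -> R) (D : R) :
  (forall n w, 0 <= Q n w) ->
  (forall n, P.-integrable setT (EFin \o Q n)) ->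
  (forall n, \int[P]_w Q n w <= D / (n.+1%:R * n.+2%:R)) ->
  {ae P, forall w, Q n w @[n --> \oo] --> 0}.
Proof.
move=> Q0 iQ QD.
have mQ n : measurable_fun setT (EFin \o Q n) by case/integrableP : (iQ n).
have D0 : 0 <= D.
  have := le_trans (Rintegral_ge0 P (fun w _ => Q0 0%N w)) (QD 0%N).
  by rewrite pmulr_lge0.
pose S w := (\sum_(n <oo) (Q n w)%:E)%E.
have S0 w : (0 <= S w)%E by apply: nneseries_ge0 => n _ _; rewrite lee_fin.
have mS : measurable_fun setT S.
  apply: (ge0_emeasurable_sum (h := fun n w => (Q n w)%:E) (P := xpredT)).
    by move=> n w _ _; rewrite lee_fin.
  by move=> n _; exact: mQ.
have iS : P.-integrable setT S.
  apply/integrableP; split=> //.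
  rewrite (eq_integral S); last by move=> w _; rewrite gee0_abs.
  rewrite /S integral_nneseries//; last by move=> n w _; rewrite lee_fin.
  apply: (@le_lt_trans _ _ D%:E); last exact: ltry.
  apply: lime_le.
    by apply: is_cvg_nneseries => n _ _; apply: integral_ge0 => w _; rewrite lee_fin.
  apply: nearW => n; rewrite big_mkord.
  apply: (@le_trans _ _ (\sum_(i < n) (D / (i.+1%:R * i.+2%:R))%:E)%E).
    apply: lee_sum => i _.
    rewrite -[leLHS]fineK ?lee_fin ?QD//.
    exact: (integrable_fin_num measurableT (iQ i)).
  rewrite sumEFin lee_fin -mulr_sumr ler_piMr//; exact: sum_inv_mul_succ_le.
have := integrable_ae measurableT iS.
apply: filterS => w /(_ Logic.I) Sfin.
have Slt : (S w < +oo)%E by rewrite -ge0_fin_numE.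
exact: (cvg_series_cvg_0 (nnseries_is_cvg (fun n => Q0 n w) Slt)).
Qed.

End AlmostSureConvergence.

(** * The centered part of the ensemble is negligible almost surely *)

Section Noise.
Context d (T : measurableType d) (R : realType) (P : probability T R).
Variable xi : nat -> {RV P >-> R}.
Hypothesis xi_exch : exchangeable xi.
Hypothesis xi_mom : forall i, finite_moments (xi i).
Variables (dist : nat -> nat -> nat -> nat) (b : nat -> nat).
Hypothesis geom : band_geometry dist.
Variable X : forall N : nat, T -> 'M[R]_N.
Hypothesis X_band : de_finetti_band_ensemble dist b xi X.

(** Each position is folded onto the upper triangle before being looked up in the filling order, so
    two positions share a variable only if they are equal or transposed. *)
Lemma ensemble_index N : exists idx : 'I_N -> 'I_N -> nat,
  [/\ forall (i j : 'I_N) w, (dist N i j <= b N)%N -> X N w i j = xi (idx i j) w,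
      forall i j : 'I_N, (dist N i j <= b N)%N -> (idx i j < N * N)%N &
      forall i j i' j' : 'I_N, (dist N i j <= b N)%N -> (dist N i' j' <= b N)%N ->
        idx i j = idx i' j' -> i = i' /\ j = j' \/ i = j' /\ j = i'].
Proof.
have [sym _ _] := geom N; have [Xsym _ [s [s_band Xs]]] := X_band N.
pose pr (i j : 'I_N) := if (i <= j)%N then (i, j) else (j, i).
have pr_s (i j : 'I_N) : (dist N i j <= b N)%N -> pr i j \in s.
  move=> ij; rewrite (perm_mem s_band) mem_enum inE /pr.
  by case: (leqP i j) => [->//|/ltnW ->]/=; rewrite sym.
exists (fun i j => index (pr i j) s); split.
- move=> i j w ij; rewrite -(Xs w _ (pr_s _ _ ij)) /pr.
  by case: ifP => //= _; rewrite -[in LHS](Xsym w) mxE.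
- move=> i j ij; have szs : (size s <= N * N)%N.
    rewrite (perm_size s_band) -cardE; apply: leq_trans (max_card _) _.
    by rewrite card_prod card_ord.
  by apply: leq_trans szs; rewrite index_mem pr_s.
- move=> i j i' j' ij ij' /(congr1 (nth (i, j) s)).
  rewrite !nth_index ?pr_s// /pr.
  by case: ifP => _; case: ifP => _ [] -> ->; [left|right|right|left].
Qed.

Definition noise n N w : 'M[R]_N :=
  X N w - empirical_mean xi n w *: band_mx R dist b N.

Lemma noise_out n N w (i j : 'I_N) : (b N < dist N i j)%N -> noise n N w i j = 0.
Proof.
move=> ij; have [_ Xout _] := X_band N.
by rewrite !mxE (Xout w i j ij) leqNgt ij mulr0 subrr.
Qed.

Lemma noise_in n N (idx : 'I_N -> 'I_N -> nat) w (i j : 'I_N) :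
  (forall (i j : 'I_N) w, (dist N i j <= b N)%N -> X N w i j = xi (idx i j) w) ->
  (dist N i j <= b N)%N -> noise n N w i j = centered xi n (idx i j) w.
Proof. by move=> Xidx ij; rewrite !mxE Xidx// ij mulr1. Qed.

Lemma all_moments_noise n N (i j : 'I_N) :
  all_moments P (fun w => noise n N w i j).
Proof.
have [idx [Xidx _ _]] := ensemble_index N.
have [ij|ij] := leqP (dist N i j) (b N).
  by under eq_fun do rewrite (noise_in _ _ Xidx ij); exact: all_moments_centered.
by under eq_fun do rewrite noise_out//; exact: all_moments_cst.
Qed.

(** The omitted terms [l = i] and [l = j] both contain the variable at position [(i, j)]. In the
    remaining ones all variables are distinct, as [pair_sum_moment_le] requires. *)
Definition cross n N w (i j : 'I_N) : R :=
  \sum_(l | (l != i) && (l != j)) noise n N w l i * noise n N w l j.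
Arguments cross : clear implicits.

Lemma all_moments_cross n N (i j : 'I_N) :
  all_moments P (fun w => cross n N w i j).
Proof.
by apply: all_moments_sum => l; apply: all_momentsM; exact: all_moments_noise.
Qed.

Lemma noise_moment_le n N (i j : 'I_N) p : (0 < p)%N ->
  \int[P]_w (noise n N w i j ^+ (2 * p)) <= moment_bound xi p.
Proof.
move=> p0; have [idx [Xidx _ _]] := ensemble_index N.
have [ij|ij] := leqP (dist N i j) (b N).
  under eq_Rintegral do rewrite (noise_in _ _ Xidx ij).
  exact: centered_moment_le.
under eq_Rintegral do rewrite noise_out// expr0n muln_eq0/= eqn0Ngt p0.
by rewrite Rintegral_cst// mul0r moment_bound_ge0.
Qed.

(** An instance of [pair_sum_moment_le] with at most [bandwidth b N] summands; [N * N <= n] places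
    all variables of the matrix among the first [n]. *)
Lemma cross_moment_le n N (i j : 'I_N) k : i != j ->
  (0 < k)%N -> (N * N <= n)%N -> (4 * k < n)%N ->
  \int[P]_w (cross n N w i j ^+ (2 * k)) <= pair_sum_const xi k *
   ((k ^ (2 * k) * bandwidth b N ^ k)%:R +
    (bandwidth b N ^ (2 * k))%:R / (n - 4 * k)%:R).
Proof.
move=> ij k0 Nn kn; have [idx [Xidx idxN idx_inj]] := ensemble_index N.
have [sym _ card_le] := geom N.
case: n Nn kn => // n Nn kn.
pose A := [set l : 'I_N | [&& l != i, l != j, dist N l i <= b N & dist N l j <= b N]%N]%SET.
have crossE w : cross n.+1 N w i j = \sum_(t < #|A|)
   centered xi n.+1 (inord (idx (enum_val t) i) : 'I_n.+1) w *
   centered xi n.+1 (inord (idx (enum_val t) j) : 'I_n.+1) w.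
  rewrite -(big_enum_val (A := mem A) (fun l =>
    centered xi n.+1 (inord (idx l i) : 'I_n.+1) w *
    centered xi n.+1 (inord (idx l j) : 'I_n.+1) w))/= /cross big_mkcond/=.
  rewrite [RHS]big_mkcond/=; apply: eq_bigr => l _; rewrite inE.
  case: (eqVneq l i) => //= li; case: (eqVneq l j) => //= lj.
  have [dli|dli] := leqP (dist N l i) (b N); last by rewrite noise_out// mul0r.
  have [dlj|dlj] := leqP (dist N l j) (b N); last by rewrite mulrC noise_out// mul0r.
  by rewrite !(noise_in _ _ Xidx)//= !inordK//; apply: leq_trans Nn; apply: idxN.
under eq_Rintegral do rewrite crossE.
have inA (t : 'I_#|A|) : [/\ enum_val t != i, enum_val t != j,
    (dist N (enum_val t) i <= b N)%N & (dist N (enum_val t) j <= b N)%N].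
  by have := enum_valP t; rewrite inE => /and4P[].
have inj_inord x y : (x < N * N)%N -> (y < N * N)%N ->
    inord x = inord y :> 'I_n.+1 -> x = y.
  move=> xN yN /(congr1 val)/=; rewrite !inordK//; exact: leq_trans Nn.
have Aw : (#|A| <= bandwidth b N)%N.
  apply: leq_trans (card_le i (b N)); apply/subset_leq_card/fintype.subsetP => l.
  by rewrite !inE (sym i) => /and4P[].
apply: le_trans (pair_sum_moment_le xi_exch xi_mom _ _ _ _ _) _ => //.
(* Shared variables sit at equal or transposed positions; here and in the next two goals, every
   unwanted case equates a summation index with [i] or [j], or [i] with [j]. *)
- move=> t u /inj_inord; have [ti tj dti dtj] := inA t; have [ui uj dui duj] := inA u.
  move=> /(_ (idxN _ _ dti) (idxN _ _ dui)) /(idx_inj _ _ _ _ dti dui) [[]|[e]].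
    by move=> /enum_val_inj.
  by rewrite e eqxx in ti.
- move=> t u /inj_inord; have [ti tj dti dtj] := inA t; have [ui uj dui duj] := inA u.
  move=> /(_ (idxN _ _ dtj) (idxN _ _ duj)) /(idx_inj _ _ _ _ dtj duj) [[]|[e]].
    by move=> /enum_val_inj.
  by rewrite e eqxx in tj.
- move=> t u; apply/eqP => /inj_inord.
  have [ti tj dti dtj] := inA t; have [ui uj dui duj] := inA u.
  move=> /(_ (idxN _ _ dti) (idxN _ _ duj)) /(idx_inj _ _ _ _ dti duj) [[_ e]|[e _]].
    by rewrite e eqxx in ij.
  by rewrite e eqxx in tj.
rewrite ler_wpM2l ?pair_sum_const_ge0//; apply: lerD.
  by rewrite ler_nat leq_mul2l leq_exp2r// Aw orbT.
by rewrite ler_wpM2r ?invr_ge0// ler_nat leq_exp2r// muln_gt0.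
Qed.

(** A sum of even powers dominates each of its terms, so a small [energy] controls all entries at
    once: this is the union bound. The diagonal has no cross term, being controlled by the squared
    entries. *)
Definition energy n k N w : R := \sum_(i < N) \sum_(j < N)
  ((if i == j then 0 else cross n N w i j / (bandwidth b N)%:R) ^+ (2 * k) +
   (noise n N w i j ^+ 2 / (bandwidth b N)%:R) ^+ (2 * k)).

Lemma energy_ge0 n k N w : 0 <= energy n k N w.
Proof.
by do 2!(apply: sumr_ge0 => ? _); rewrite addr_ge0// exprM exprn_ge0// sqr_ge0.
Qed.

Lemma all_moments_energy_summand n k N (i j : 'I_N) :
  all_moments P (fun w => (if i == j then 0 else cross n N w i j / (bandwidth b N)%:R) ^+ (2 * k))
  /\ all_moments P (fun w => (noise n N w i j ^+ 2 / (bandwidth b N)%:R) ^+ (2 * k)).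
Proof.
split; apply: all_momentsX.
  case: (i == j); first exact: all_moments_cst.
  by apply: all_momentsM; [exact: all_moments_cross|exact: all_moments_cst].
by apply: all_momentsM; [apply: all_momentsX; exact: all_moments_noise|exact: all_moments_cst].
Qed.

Lemma all_moments_energy n k N : all_moments P (energy n k N).
Proof.
apply: all_moments_sum => i; apply: all_moments_sum => j.
by have [? ?] := all_moments_energy_summand n k i j; exact: all_momentsD.
Qed.

(** There are [N ^ 2] summands. Division by [w ^+ (2 * k)] turns the two parts of the cross moment
    into [1 / w ^+ k] and [1 / (n - 4 * k)], up to constants. *)
Lemma energy_integral_le n k N : (0 < k)%N -> (0 < N)%N ->
  (N * N <= n)%N -> (4 * k < n)%N ->
  \int[P]_w energy n k N w <= N%:R ^+ 2 *
    ((pair_sum_const xi k * (k ^ (2 * k))%:R + moment_bound xi (2 * k)) / (bandwidth b N)%:R ^+ k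
     + pair_sum_const xi k / (n - 4 * k)%:R).
Proof.
move=> k0 N0 Nn kn.
set w : R := (bandwidth b N)%:R.
have w0 : 0 < w by rewrite ltr0n bandwidth_gt0.
have w1 : 1 <= w by rewrite ler1n bandwidth_gt0.
have C0 := pair_sum_const_ge0 xi k; have B0 := moment_bound_ge0 xi (2 * k).
rewrite /energy Rintegral_sum; last first.
  move=> i; apply: all_moments_sum => j.
  by have [? ?] := all_moments_energy_summand n k i j; exact: all_momentsD.
set Z := (X in _ * X).
suff le i j : \int[P]_x ((if i == j then 0 else cross n N x i j / w) ^+ (2 * k) +
   (noise n N x i j ^+ 2 / w) ^+ (2 * k)) <= Z.
  apply: (@le_trans _ _ (\sum_(i < N) \sum_(j < N) Z)).
    apply: ler_sum => i _; rewrite Rintegral_sum.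
      by apply: ler_sum => j _; exact: le.
    by move=> j; have [? ?] := all_moments_energy_summand n k i j; exact: all_momentsD.
  by rewrite !sumr_const !card_ord -mulrnA -[leLHS]mulr_natl natrM expr2.
have [m1 m2] := all_moments_energy_summand n k i j.
rewrite RintegralD//; try exact: all_moments_integrable.
(* The moments of squared entries even gain [w ^+ (2 * k)]; this is weakened to match the cross
   terms. *)
have wk : (w ^+ (2 * k))^-1 <= (w ^+ k)^-1.
  by rewrite lef_pV2 ?posrE ?exprn_gt0//; apply: ler_weXn2l; rewrite ?leq_pmull.
apply: (@le_trans _ _ ((pair_sum_const xi k * (k ^ (2 * k))%:R / w ^+ k +
   pair_sum_const xi k / (n - 4 * k)%:R) + moment_bound xi (2 * k) / w ^+ k)); last first.
  by rewrite /Z mulrDl; lra.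
apply: lerD.
  have [_|ij] := eqVneq i j.
    under eq_Rintegral do rewrite expr0n muln_eq0/= eqn0Ngt k0.
    rewrite Rintegral_cst// mul0r; apply: addr_ge0; last by rewrite divr_ge0.
    apply: divr_ge0; first by apply: mulr_ge0.
    by rewrite exprn_ge0// ltW.
  under eq_Rintegral do rewrite expr_div_n.
  rewrite RintegralZr//; last first.
    by apply: all_moments_integrable; apply: all_momentsX; exact: all_moments_cross.
  apply: le_trans (ler_wpM2r _ (cross_moment_le ij k0 Nn kn)) _.
    by rewrite invr_ge0 exprn_ge0// ltW.
  rewrite natrM !natrX -/w.
  rewrite [leLHS](_ : _ = pair_sum_const xi k * k%:R ^+ (2 * k) / w ^+ k + pair_sum_const xi k / (n - 4 * k)%:R)//.
  have wk0 : w ^+ k != 0 by rewrite expf_neq0// gt_eqF.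
  have n0 : (n - 4 * k)%:R != 0 :> R by rewrite pnatr_eq0 -lt0n subn_gt0.
  have -> : w ^+ (2 * k) = w ^+ k * w ^+ k by rewrite mul2n -addnn exprD.
  move: wk0 n0; move: (w ^+ k) (k%:R ^+ (2 * k)) (n - 4 * k)%:R (pair_sum_const xi k).
  by move=> v a m C v0 m0; field; rewrite m0 v0.
under eq_Rintegral do rewrite expr_div_n -exprM.
rewrite RintegralZr//; last first.
  by apply: all_moments_integrable; apply: all_momentsX; exact: all_moments_noise.
apply: ler_pM => //.
- by apply: Rintegral_ge0 => x _; rewrite exprM exprn_ge0// sqr_ge0.
- by rewrite invr_ge0 exprn_ge0// ltW.
- by apply: noise_moment_le; rewrite muln_gt0.
Qed.

Lemma opnorm_noise_energy n k N w (e : R) : (0 < k)%N -> 0 <= e ->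
  energy n k N w <= (e ^+ 2 / 7) ^+ (2 * k) ->
  opnorm (noise n N w) / (bandwidth b N)%:R <= e.
Proof.
move=> k0 e0 Ee.
case: N Ee => [|N] Ee; first by rewrite /bandwidth min0n invr0 mulr0.
set W : R := (bandwidth b N.+1)%:R.
have W0 : 0 < W by rewrite ltr0n bandwidth_gt0.
(* With [h = s = e' * W], the bound [5 * h + 2 * s] of [opnorm_band_le] becomes
   [7 * e' * W = e ^+ 2 * W]. *)
set e' : R := e ^+ 2 / 7; have e'0 : 0 <= e' by rewrite divr_ge0 ?sqr_ge0.
have summand_le i j : (if i == j then 0 else cross n N.+1 w i j / W) ^+ (2 * k) +
   (noise n N.+1 w i j ^+ 2 / W) ^+ (2 * k) <= e' ^+ (2 * k).
  apply: le_trans Ee; rewrite /energy (bigD1 i)//= (bigD1 j)//= -addrA lerDl.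
  rewrite addr_ge0//; do ?(apply: sumr_ge0 => ? _);
    by rewrite addr_ge0// exprM exprn_ge0// sqr_ge0.
have root_le (x : R) : x ^+ (2 * k) <= e' ^+ (2 * k) -> `|x| <= e'.
  by rewrite -(expr_even_norm x) ler_pXn2r ?nnegrE// muln_gt0.
have even_ge0 (x : R) : 0 <= x ^+ (2 * k) by rewrite exprM exprn_ge0// sqr_ge0.
rewrite ler_pdivrMr//.
have -> : e * W = Num.sqrt (W * (5 * (e' * W) + 2 * (e' * W))).
  rewrite [X in Num.sqrt X](_ : _ = (e * W) ^+ 2); last by rewrite /e'; field.
  by rewrite sqrtr_sqr ger0_norm// mulr_ge0// ltW.
apply: opnorm_band_le => //.
- by rewrite mulr_ge0// ltW.
- by rewrite mulr_ge0// ltW.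
- by move=> i j; exact: noise_out.
- move=> i j; rewrite -ler_pdivrMr//; apply: le_trans (ler_norm _) _.
  by apply: root_le; apply: le_trans (summand_le i j); rewrite lerDr.
- move=> i j ij; rewrite -ler_pdivrMr// -[X in _ / X](ger0_norm (ltW W0)) -normf_div.
  apply: root_le; apply: le_trans (summand_le i j); rewrite (negbTE ij) lerDl//.
Qed.

Hypothesis w_ge : exists c q : R, [/\ 0 < c, 0 < q &
  forall N : nat, (0 < N)%N -> c * (N%:R `^ q) <= (bandwidth b N)%:R].

(** The number [nu N] of averaged variables grows so fast that the expected energies are
    [O(1 / N^2)], hence summable; [N <= nu N] later gives convergence of the means. *)
Lemma noise_opnorm_cvg0 : exists nu : nat -> nat, (forall N, (N <= nu N)%N) /\
  {ae P, forall w, opnorm (noise (nu N) N w) / (bandwidth b N)%:R @[N --> \oo] --> 0}.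
Proof.
have [c [q [c0 q0 cw]]] := w_ge.
(* With [q * k > 4] the power [w ^+ k] grows at least like [N ^ 4], which beats the [N ^ 2] entries
   by a summable factor. *)
pose k := Num.bound (4 / q).
have kq : 4 < q * k%:R.
  by rewrite mulrC -ltr_pdivrMr//; apply: archi_boundP; rewrite divr_ge0// ltW.
have k0 : (0 < k)%N.
  by rewrite lt0n; apply/eqP => kE; move: kq; rewrite kE mulr0; lra.
(* Subtracting [4 * k] leaves [N ^ 4 + 1], which is positive and at least [N ^ 4]. *)
pose nu N := (N ^ 4 + 4 * k).+1.
have expN m N : (0 < m <= 4)%N -> (N ^ m <= nu N)%N.
  move=> /andP[m0 m4]; apply: leqW; apply: leq_trans (leq_addr _ _).
  by case: N => [|N]; rewrite ?exp0n// leq_pexp2l.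
have nuN N : (N * N <= nu N)%N by rewrite mulnn expN.
exists nu; split.
  by move=> N; rewrite -[leqLHS]expn1 expN.
pose D1 := (pair_sum_const xi k * (k ^ (2 * k))%:R + moment_bound xi (2 * k)).
(* The [6] comes from [(M + 1) * (M + 2) <= 6 * M ^+ 2] for [M >= 1]. *)
pose D := 6 * (D1 / c ^+ k + pair_sum_const xi k).
have C0 := pair_sum_const_ge0 xi k; have B0 := moment_bound_ge0 xi (2 * k).
have D10 : 0 <= D1 by rewrite addr_ge0// mulr_ge0.
have ck0 : 0 < c ^+ k by rewrite exprn_gt0.
have wk N : (0 < N)%N -> c ^+ k * N%:R ^+ 4 <= (bandwidth b N)%:R ^+ k.
  move=> N0; have N1 : 1 <= N%:R :> R by rewrite ler1n.
  apply: (@le_trans _ _ ((c * N%:R `^ q) ^+ k)); last first.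
    by rewrite lerXn2r ?nnegrE ?mulr_ge0 ?powR_ge0 ?(ltW c0)// cw.
  rewrite exprMn ler_wpM2l ?(ltW ck0)// -[leRHS]powR_mulrn ?powR_ge0//.
  rewrite -powRrM -powR_mulrn ?ler0n//.
  by apply: ler_powR => //; exact: ltW.
have Edec N : \int[P]_w energy (nu N) k N w <= D / (N.+1%:R * N.+2%:R).
  case: N => [|N].
    under eq_Rintegral do rewrite /energy big_ord0.
    rewrite Rintegral_cst// mul0r divr_ge0// mulr_ge0// addr_ge0//.
    by rewrite divr_ge0// ltW.
  apply: le_trans (energy_integral_le k0 _ (nuN _) _) _ => //.
    by rewrite /nu; lia.
  set M : R := N.+1%:R; have M1 : 1 <= M by rewrite ler1n.
  have M0 : 0 < M by rewrite ltr0n.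
  apply: (@le_trans _ _ (M ^+ 2 * (D1 / (c ^+ k * M ^+ 4) + pair_sum_const xi k / M ^+ 4))).
    rewrite ler_wpM2l ?sqr_ge0//; apply: lerD.
      rewrite ler_wpM2l// lef_pV2 ?posrE ?wk ?mulr_gt0 ?exprn_gt0//.
      by rewrite ltr0n bandwidth_gt0.
    rewrite ler_wpM2l// lef_pV2 ?posrE ?exprn_gt0// ?ltr0n ?subn_gt0; last first.
      by rewrite /nu; lia.
    by rewrite /M -natrX ler_nat /nu; lia.
  have -> : N.+2%:R = M + 1 by rewrite /M natr1.
  have -> : N.+3%:R = M + 2 by rewrite /M -natrD addn2.
  rewrite ler_pdivlMr ?mulr_gt0 ?addr_gt0//.
  set G := D1 / c ^+ k + pair_sum_const xi k.
  have G0 : 0 <= G by rewrite addr_ge0// divr_ge0// ltW.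
  have -> : M ^+ 2 * (D1 / (c ^+ k * M ^+ 4) + pair_sum_const xi k / M ^+ 4) = G / M ^+ 2.
    by rewrite /G; field; rewrite !gt_eqF.
  rewrite mulrAC ler_pdivrMr ?exprn_gt0// /D -/G [6 * G]mulrC -mulrA ler_wpM2l//.
  by rewrite expr2; nra.
have := ae_cvg0_summable (fun N w => energy_ge0 (nu N) k N w)
  (fun N => all_moments_integrable (all_moments_energy (nu N) k N)) Edec.
apply: filterS => w Ew; apply/cvgrPdist_le => e e0.
have e1 : 0 < (e ^+ 2 / 7) ^+ (2 * k) by rewrite exprn_gt0// divr_gt0 ?exprn_gt0.
have /cvgrPdist_le/(_ _ e1) := Ew.
apply: filterS => N; rewrite !sub0r !normrN ger0_norm ?energy_ge0// => EN.
rewrite ger0_norm ?divr_ge0 ?opnorm_ge0//.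
exact: opnorm_noise_energy k0 (ltW e0) EN.
Qed.

End Noise.

(** * Upper and lower limits of real sequences, taken in the extended reals *)

Section LimSupInf.
Variable R : realType.
Implicit Types (u : nat -> R) (l : R).

Lemma limn_esup_le_near u l :
  (forall e, 0 < e -> \forall n \near \oo, u n <= l + e) ->
  (limn_esup (fun n => (u n)%:E) <= l%:E)%E.
Proof.
move=> ul; rewrite limn_esup_lim; apply/lee_addgt0Pr => e e0.
apply: lime_le; first exact: is_cvg_esups.
have [m _ mP] := ul e e0; exists m => // n /= mn.
apply: ge_ereal_sup => _ [k /= nk <-]; rewrite -EFinD lee_fin; apply: mP.
exact: leq_trans nk.
Qed.

Lemma limn_einf_ge_near u l :
  (forall e, 0 < e -> \forall n \near \oo, l - e <= u n) ->
  (l%:E <= limn_einf (fun n => (u n)%:E))%E.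
Proof.
move=> ul; rewrite limn_einf_lim; apply/lee_addgt0Pr => e e0.
rewrite -leeBlDr// -EFinB; apply: lime_ge; first exact: is_cvg_einfs.
have [m _ mP] := ul e e0; exists m => // n /= mn.
apply: le_ereal_inf_tmp => _ [k /= nk <-]; rewrite lee_fin; apply: mP.
exact: leq_trans nk.
Qed.

(** Convergence is squeezed between the two limits. This form also shows that a convergence event is
    measurable. *)
Lemma cvg_limn_esup_einf u l : u n @[n --> \oo] --> l <->
  (limn_esup (fun n => (u n)%:E) <= l%:E)%E /\
  (l%:E <= limn_einf (fun n => (u n)%:E))%E.
Proof.
split=> [/cvgrPdist_le ul|[supl infl]].
  split; [apply: limn_esup_le_near|apply: limn_einf_ge_near] => e /ul;
    apply: filterS => n; rewrite ler_distl => /andP[]; lra.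
set v := fun n => (u n)%:E.
have eq_sup : limn_esup v = l%:E.
  by apply/eqP; rewrite eq_le supl (le_trans infl)// limn_einf_sup.
have eq_inf : limn_einf v = l%:E.
  by apply/eqP; rewrite eq_le infl andbT (le_trans _ supl)// limn_einf_sup.
suff : v n @[n --> \oo] --> l%:E by move/fine_cvg.
apply: (@squeeze_cvge _ _ _ _ (einfs v) _ (esups v)).
- apply: nearW => n; apply/andP; split.
    by apply: ereal_inf_lbound; exists n => /=.
  by apply: ereal_sup_ubound; exists n => /=.
- by rewrite -eq_inf limn_einf_lim; exact: is_cvg_einfs.
- by rewrite -eq_sup limn_esup_lim; exact: is_cvg_esups.
Qed.

End LimSupInf.

(** * Almost sure bounds on the scaled operator norm *)

Section EnsembleLimits.
Context d (T : measurableType d) (R : realType) (P : probability T R).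

Lemma probability1_ae (A : set T) :
  measurable A -> {ae P, forall w, A w} -> P A = 1%E.
Proof.
move=> mA [N [mN N0 AN]]; apply/eqP; rewrite eq_le probability_le1//=.
rewrite -[A]setCK probability_setC; last exact: measurableC.
have -> : P (~` A) = 0%E.
  by apply/eqP; rewrite -measure_le0 -N0 le_measure// ?inE//; exact: measurableC.
by rewrite sube0.
Qed.

Variable xi : nat -> {RV P >-> R}.
Hypothesis xi_exch : exchangeable xi.
Hypothesis xi_mom : forall i, finite_moments (xi i).
Variable M : {RV P >-> R}.
Hypothesis M_lim : is_limiting_empirical_mean xi M.
Variables (dist : nat -> nat -> nat -> nat) (b : nat -> nat).
Hypothesis geom : band_geometry dist.
Hypothesis w_ge : exists c q : R, [/\ 0 < c, 0 < q &
  forall N : nat, (0 < N)%N -> c * (N%:R `^ q) <= (bandwidth b N)%:R].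
Variable X : forall N : nat, T -> 'M[R]_N.
Hypothesis X_band : de_finetti_band_ensemble dist b xi X.

Lemma measurable_scaled_opnorm N :
  measurable_fun setT (fun w => scaled_opnorm b X w N).
Proof.
apply: measurable_funM => //; apply: measurable_opnorm => i j.
have [idx [Xidx _ _]] := ensemble_index geom X_band N.
have [ij|ij] := leqP (dist N i j) (b N).
  under eq_fun do rewrite (Xidx _ _ _ ij).
  exact: measurable_funPT.
have [_ Xout _] := X_band N.
by under eq_fun do rewrite (Xout _ _ _ ij); exact: measurable_cst.
Qed.

Definition band_density N : R :=
  (\sum_(i < N) #|[set j : 'I_N | dist N i j <= b N]%SET|)%N%:R /
  (N%:R * (bandwidth b N)%:R).

Lemma opnorm_band_mx_ge N : (0 < N)%N ->
  band_density N * (bandwidth b N)%:R <= opnorm (band_mx R dist b N).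
Proof.
move=> N0; apply: le_trans (opnorm_ge_avg _).
rewrite /band_density invfM mulrA mulfVK ?pnatr_eq0 -?lt0n ?bandwidth_gt0//.
rewrite natr_sum ler_wpM2r// ler_sum// => i _.
rewrite -sum1_card natr_sum big_mkcond/=; apply: ler_sum => j _.
by rewrite mxE inE; case: leqP.
Qed.

(** All the probability is condensed here: [m] is the mean of the first [nu N] variables and [delta]
    the scaled norm of the noise, and what follows is real analysis at a fixed sample point. *)
Lemma scaled_opnorm_ae_bounds : {ae P, forall w, exists m delta : nat -> R,
  [/\ m n @[n --> \oo] --> M w, delta n @[n --> \oo] --> 0 &
    forall N, (0 < N)%N ->
      band_density N * `|m N| - delta N <= scaled_opnorm b X w N <= `|m N| + delta N]}.
Proof.
have [nu [nuN cvg_noise]] := noise_opnorm_cvg0 xi_exch xi_mom geom X_band w_ge.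
move: cvg_noise M_lim; apply: filterS2 => w cvg_noise cvgM.
exists (fun N => empirical_mean xi (nu N) w).
exists (fun N => opnorm (noise xi dist b X (nu N) N w) / (bandwidth b N)%:R).
split=> //.
  apply: (cvg_comp _ _ _ cvgM) => A [m _ mA].
  by exists m => // n /= mn; apply: mA => /=; exact: leq_trans (nuN n).
move=> N N0; set m := empirical_mean _ _ _; set Y := noise _ _ _ _ _ _ _.
set W : R := (bandwidth b N)%:R; set B := band_mx R dist b N.
have W0 : 0 < W by rewrite ltr0n bandwidth_gt0.
have XE : X N w = m *: B + Y by rewrite /Y /noise addrC subrK.
rewrite /scaled_opnorm -/W; apply/andP; split.
  rewrite ler_pdivlMr// mulrBl divfK ?gt_eqF// lerBlDr.
  apply: (@le_trans _ _ (opnorm (m *: B))).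
    by rewrite opnormZ mulrAC [leRHS]mulrC ler_wpM2r// opnorm_band_mx_ge.
  have -> : m *: B = X N w + - Y by rewrite XE addrK.
  by apply: le_trans (opnormD _ _) _; rewrite opnormN.
rewrite ler_pdivrMr// mulrDl divfK ?gt_eqF// XE.
apply: le_trans (opnormD _ _) _; rewrite lerD2r opnormZ ler_wpM2l//.
exact: opnorm_band_mx_le.
Qed.

Let cvg_norm_near (m : nat -> R) l e : m n @[n --> \oo] --> l -> 0 < e ->
  \forall n \near \oo, `|l| - e <= `|m n| <= `|l| + e.
Proof.
by move=> /cvg_norm/cvgrPdist_le/[apply]; apply: filterS => n; rewrite ler_distlC.
Qed.

Lemma limsup_opnorm_ae : {ae P, forall w,
  (limn_esup (fun N => (scaled_opnorm b X w N)%:E) <= `|M w|%:E)%E}.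
Proof.
move: scaled_opnorm_ae_bounds; apply: filterS => w [m [delta [mM /cvgrPdist_le d0 Xb]]].
apply: limn_esup_le_near => e e0; have e2 : 0 < e / 2 by lra.
near=> N.
have /andP[_] : band_density N * `|m N| - delta N <= scaled_opnorm b X w N <= `|m N| + delta N.
  by apply: Xb; near: N; exists 1%N.
have /andP[_] : `|M w| - e / 2 <= `|m N| <= `|M w| + e / 2.
  by near: N; exact: cvg_norm_near.
have : `|0 - delta N| <= e / 2 by near: N; exact: d0.
rewrite sub0r normrN ler_norml => /andP[]; lra.
Unshelve. all: by end_near. Qed.

(** A general asymptotic lower bound [rho] of the density serves both [3 / 4] and [1]. *)
Lemma liminf_opnorm_ae (rho : R) : 0 <= rho ->
  (forall e, 0 < e -> \forall N \near \oo, rho - e <= band_density N) ->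
  {ae P, forall w,
  ((rho * `|M w|)%:E <= limn_einf (fun N => (scaled_opnorm b X w N)%:E))%E}.
Proof.
move=> rho0 rhoN; move: scaled_opnorm_ae_bounds.
apply: filterS => w [m [delta [mM /cvgrPdist_le d0 Xb]]].
apply: limn_einf_ge_near => e e0.
(* With an error [f <= 1] in the density, the mean and the noise, the total loss is at most
   [f * K <= e]. *)
pose K := rho + `|M w| + 2; have K0 : 2 <= K by rewrite lerDr addr_ge0.
pose f := Num.min 1 (e / K).
have f0 : 0 < f by rewrite lt_min ltr01 divr_gt0//; lra.
near=> N.
have /andP[+ _] : band_density N * `|m N| - delta N <= scaled_opnorm b X w N <= `|m N| + delta N.
  by apply: Xb; near: N; exists 1%N.
have /andP[+ _] : `|M w| - f <= `|m N| <= `|M w| + f.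
  by near: N; exact: cvg_norm_near.
have : `|0 - delta N| <= f by near: N; exact: d0.
rewrite sub0r normrN ler_norml => /andP[_].
have : rho - f <= band_density N by near: N; exact: rhoN.
have : f * K <= e.
  by rewrite -ler_pdivlMr ?ge_min ?lexx ?orbT//; lra.
have : f <= 1 by rewrite ge_min lexx.
have : 0 <= band_density N by rewrite divr_ge0.
have := normr_ge0 (M w); have := normr_ge0 (m N); rewrite /K.
set a := `|M w|; set x := `|m N|; set D := band_density N.
move=> x0 a0 D0 f1 fK Drho df Mx Ds.
have D_x : D * (a - f) <= D * x by rewrite ler_wpM2l//; lra.
(* If [a < f], the factor [a - f] is negative and cannot multiply the density bound, but then
   [rho * a] itself is below the allowed loss. *)
have [fa|af] := leP f a.
  have : (rho - f) * (a - f) <= D * (a - f) by rewrite ler_wpM2r//; lra.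
  have := sqr_ge0 f; nra.
have : rho * a <= rho * f by rewrite ler_wpM2l// ltW.
have : 0 <= D * x by exact: mulr_ge0.
have : 0 <= f * a by rewrite mulr_ge0// ltW.
by nra.
Unshelve. all: by end_near. Qed.

End EnsembleLimits.

(** * Lower bounds on the density of the bands *)

Section BandDensity.
Variables (R : realType) (b : nat -> nat).
Hypothesis b_lt : forall N : nat, (0 < N)%N -> (b N <= N - 1)%N.

Lemma band_density_ge (dist : nat -> nat -> nat -> nat) N (rho : R) : (0 < N)%N ->
  rho * (N%:R * (bandwidth b N)%:R) <=
    (\sum_(i < N) #|[set j : 'I_N | dist N i j <= b N]%SET|)%N%:R ->
  rho <= band_density R dist b N.
Proof.
move=> N0 le; rewrite /band_density ler_pdivlMr//.
by rewrite mulr_gt0 ?ltr0n ?bandwidth_gt0.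
Qed.

Lemma periodic_density_ge1 N : (0 < N)%N -> 1 <= band_density R periodic_dist b N.
Proof.
move=> N0; apply: band_density_ge => //; rewrite mul1r -natrM ler_nat.
rewrite -[X in (X * _)%N](card_ord N) -sum_nat_const leq_sum// => i _.
exact: periodic_row_card.
Qed.

(** With [t = b / N] the density is about [1 - t / 2] for [t <= 1 / 2] and [2 t - t^2] beyond; the
    former decreases and the latter increases, and both equal [3 / 4] at [t = 1 / 2]. *)
Lemma strict_density_ge34 N : (0 < N)%N -> 3 / 4 <= band_density R strict_dist b N.
Proof.
move=> N0; apply: band_density_ge => //.
have bN : (b N < N)%N by have := b_lt N0; lia.
have := strict_card bN; rewrite /bandwidth; set S := (\sum_(i < N) _)%N => leS.
suff : (3 * (N * minn N (2 * b N + 1)) <= 4 * S)%N.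
  rewrite -(ler_nat R) !natrM; lra.
apply: leq_trans (leq_mul (leqnn 4) leS).
have [Nb|Nb] := leqP N (2 * b N + 1).
  (* Parametrising [N] by its excess over [b N] removes the truncated subtractions. *)
  have [c cE] : exists c, N = (b N + c.+1)%N by exists (N - b N).-1; lia.
  move: Nb cE {bN leS S}; move: (b N) => a Nb cE; move: Nb; rewrite {}cE => Nb.
  have -> : (2 * (a + c.+1) - a - 1 = a + 2 * c + 1)%N by lia.
  nia.
have [c cE] : exists c, N = (2 * b N + 1 + c)%N by exists (N - (2 * b N + 1))%N; lia.
move: cE {Nb bN leS S}; move: (b N) => a ->.
have -> : (2 * (2 * a + 1 + c) - a - 1 = 3 * a + 1 + 2 * c)%N by lia.
nia.
Qed.

(** Only the [2 b] rows near the ends are cut, each losing at most [b] of its [2 b + 1]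
    positions. *)
Lemma strict_density_narrow N : (0 < N)%N -> (2 * b N + 1 <= N)%N ->
  1 - (b N)%:R / N%:R <= band_density R strict_dist b N.
Proof.
move=> N0 bN; apply: band_density_ge => //.
have bltN : (b N < N)%N by lia.
have Nr : N%:R != 0 :> R by rewrite pnatr_eq0 -lt0n.
rewrite mulrA mulrBl mul1r divfK// -natrB ?(ltnW bltN)// -natrM ler_nat.
apply: leq_trans (strict_card bltN); rewrite /bandwidth (minn_idPr bN).
have [c cE] : exists c, N = (2 * b N + 1 + c)%N by exists (N - (2 * b N + 1))%N; lia.
move: cE {N0 bN bltN Nr}; move: (b N) => a ->.
have -> : (2 * (2 * a + 1 + c) - a - 1 = 3 * a + 1 + 2 * c)%N by lia.
have -> : (2 * a + 1 + c - a = a + 1 + c)%N by lia.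
nia.
Qed.

(** Even the first and last rows keep more than [b] of their [N] positions. *)
Lemma strict_density_wide N : (0 < N)%N -> (N <= 2 * b N + 1)%N ->
  (b N)%:R / N%:R <= band_density R strict_dist b N.
Proof.
move=> N0 Nb; apply: band_density_ge => //.
have bltN : (b N < N)%N by have := b_lt N0; lia.
have Nr : N%:R != 0 :> R by rewrite pnatr_eq0 -lt0n.
rewrite mulrA divfK// -natrM ler_nat.
apply: leq_trans (strict_card bltN); rewrite /bandwidth (minn_idPl Nb).
have [c cE] : exists c, N = (b N + c.+1)%N by exists (N - b N).-1; lia.
move: cE {N0 Nb bltN Nr}; move: (b N) => a ->.
have -> : (2 * (a + c.+1) - a - 1 = a + 2 * c + 1)%N by lia.
nia.
Qed.

Lemma strict_density_cvg :
  ((b N)%:R / N%:R : R) @[N --> \oo] --> (0 : R) \/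
  ((b N)%:R / N%:R : R) @[N --> \oo] --> (1 : R) ->
  forall e, 0 < e -> \forall N \near \oo, 1 - e <= band_density R strict_dist b N.
Proof.
(* The threshold [1 / 4] decides the regime: [b / N <= 1 / 4] gives [2 b + 1 <= N] once [N >= 2],
   and [b / N >= 3 / 4] gives [N <= 2 b + 1]. *)
move=> bN e e0; have f0 : 0 < Num.min e 4^-1 by rewrite lt_min e0 invr_gt0 ltr0n.
case: bN => /cvgrPdist_le/(_ _ f0) nearb; near=> N.
- have N2 : (2 <= N)%N by near: N; exists 2%N.
  have Np : 0 < N%:R :> R by rewrite ltr0n; lia.
  have : `|0 - (b N)%:R / N%:R| <= Num.min e 4^-1 by near: N; exact: nearb.
  rewrite sub0r normrN ger0_norm ?divr_ge0// le_min => /andP[be b4].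
  apply: le_trans (strict_density_narrow _ _); [lra|lia|].
  move: b4; rewrite ler_pdivrMr// ler_pdivlMl// -natrM ler_nat; lia.
- have N2 : (0 < N)%N by near: N; exists 1%N.
  have Np : 0 < N%:R :> R by rewrite ltr0n.
  have : `|1 - (b N)%:R / N%:R| <= Num.min e 4^-1 by near: N; exact: nearb.
  rewrite ler_norml le_min => /andP[_ /andP[be b4]].
  apply: le_trans (strict_density_wide _ _) => //; first lra.
  have : 3 / 4 <= (b N)%:R / N%:R :> R by lra.
  rewrite ler_pdivlMr// => h; have : (3 * N <= 4 * b N)%N.
    by rewrite -(ler_nat R) !natrM; lra.
  lia.
Unshelve. all: by end_near. Qed.

End BandDensity.

Theorem theorem31 (d : measure_display) (T : measurableType d) (R : realType)
    (P : probability T R) (b : nat -> nat)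
    (b_lt : forall N : nat, (0 < N)%N -> (b N <= N - 1)%N)
    (w_ge : exists c q : R, [/\ 0 < c, 0 < q &
       forall N : nat, (0 < N)%N -> c * (N%:R `^ q) <= (bandwidth b N)%:R])
    (xi : nat -> {RV P >-> R})
    (xi_exch : exchangeable xi)
    (xi_mom : forall i : nat, finite_moments (xi i))
    (M : {RV P >-> R})
    (M_lim : is_limiting_empirical_mean xi M)
    (F Fper : forall N : nat, T -> 'M[R]_N)
    (F_band : de_finetti_band_ensemble strict_dist b xi F)
    (Fper_band : de_finetti_band_ensemble periodic_dist b xi Fper) :
  [/\ (forall X : forall N : nat, T -> 'M[R]_N, X = F \/ X = Fper ->
         P [set w | (limn_esup (fun N => (scaled_opnorm b X w N)%:E)
                       <= `|M w|%:E)%E] = 1%E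
         /\
         P [set w | ((3 / 4 * `|M w|)%:E
                       <= limn_einf (fun N => (scaled_opnorm b X w N)%:E))%E]
           = 1%E),
      P [set w | scaled_opnorm b Fper w N @[N --> \oo] --> `|M w|] = 1%E &
      ((b N)%:R / N%:R : R) @[N --> \oo] --> (0 : R) \/
      ((b N)%:R / N%:R : R) @[N --> \oo] --> (1 : R) ->
      P [set w | scaled_opnorm b F w N @[N --> \oo] --> `|M w|] = 1%E].
Proof.
have near_pos (rho : R) dist : (forall N, (0 < N)%N -> rho <= band_density R dist b N) ->
    forall e, 0 < e -> \forall N \near \oo, rho - e <= band_density R dist b N.
  move=> le e e0; exists 1%N => // N /= N0.
  by apply: le_trans (le N N0); rewrite gerBl ltW.
have mM (a : R) : measurable_fun setT (fun w => (a * `|M w|)%:E).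
  by apply/measurable_EFinP; apply: measurable_funM => //; exact: measurableT_comp.
(* Measurability of the events is what turns almost everywhere statements into probabilities equal
   to [1]. *)
have msup dist X (geom : band_geometry dist) (XB : de_finetti_band_ensemble dist b xi X) :
    measurable [set w | (limn_esup (fun N => (scaled_opnorm b X w N)%:E) <= `|M w|%:E)%E].
  rewrite -[X in measurable X]setTI; apply: measurable_lee => //.
    apply: (measurable_fun_limn_esup (f := fun N w => (scaled_opnorm b X w N)%:E)) => N.
    apply/measurable_EFinP.
    exact: (measurable_scaled_opnorm geom XB).
  by apply/measurable_EFinP; exact: measurableT_comp.
have minf dist X (a : R) (geom : band_geometry dist)
    (XB : de_finetti_band_ensemble dist b xi X) :
    measurable [set w | ((a * `|M w|)%:E <= limn_einf (fun N => (scaled_opnorm b X w N)%:E))%E].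
  rewrite -[X in measurable X]setTI; apply: measurable_lee => //.
  rewrite /limn_einf; apply: measurableT_comp => //.
  apply: (measurable_fun_limn_esup (f := fun N w => (- (scaled_opnorm b X w N)%:E)%E)) => N.
  apply: measurableT_comp => //; apply/measurable_EFinP.
  exact: (measurable_scaled_opnorm geom XB).
have part1 dist X (geom : band_geometry dist) (XB : de_finetti_band_ensemble dist b xi X) :
    (forall N, (0 < N)%N -> 3 / 4 <= band_density R dist b N) ->
    P [set w | (limn_esup (fun N => (scaled_opnorm b X w N)%:E) <= `|M w|%:E)%E] = 1%E /\
    P [set w | ((3 / 4 * `|M w|)%:E <= limn_einf (fun N => (scaled_opnorm b X w N)%:E))%E] = 1%E.
  move=> dens; split; apply: probability1_ae.
  - exact: (msup _ _ geom XB).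
  - exact: (limsup_opnorm_ae xi_exch xi_mom M_lim geom w_ge XB).
  - exact: (minf _ _ _ geom XB).
  - by apply: (liminf_opnorm_ae xi_exch xi_mom M_lim geom w_ge XB); [lra|exact: near_pos].
have part2 dist X (geom : band_geometry dist) (XB : de_finetti_band_ensemble dist b xi X) :
    (forall e, 0 < e -> \forall N \near \oo, 1 - e <= band_density R dist b N) ->
    P [set w | scaled_opnorm b X w N @[N --> \oo] --> `|M w|] = 1%E.
  move=> dens; apply: probability1_ae.
    (* The convergence event is the intersection of the events for the upper and the lower limit,
       the latter with factor [1]. *)
    rewrite [X in measurable X](_ : _ =
      [set w | (limn_esup (fun N => (scaled_opnorm b X w N)%:E) <= `|M w|%:E)%E] `&`
      [set w | ((1 * `|M w|)%:E <= limn_einf (fun N => (scaled_opnorm b X w N)%:E))%E]).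
      by apply: measurableI; [exact: (msup _ _ geom XB)|exact: (minf _ _ _ geom XB)].
    by apply/seteqP; split=> w /=; rewrite mul1r => /cvg_limn_esup_einf.
  have := limsup_opnorm_ae xi_exch xi_mom M_lim geom w_ge XB.
  have := liminf_opnorm_ae xi_exch xi_mom M_lim geom w_ge XB ler01 dens.
  apply: filterS2 => w; rewrite mul1r => infw supw.
  exact/cvg_limn_esup_einf.
split.
- move=> X [->|->].
    exact: (part1 _ _ strict_geometry F_band (strict_density_ge34 R b_lt)).
  apply: (part1 _ _ periodic_geometry Fper_band) => N N0.
  by apply: le_trans (periodic_density_ge1 R b N0); lra.
- exact: (part2 _ _ periodic_geometry Fper_band (near_pos _ _ (periodic_density_ge1 R b))).
- move=> bN; exact: (part2 _ _ strict_geometry F_band (strict_density_cvg b_lt bN)).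
Qed.
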